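(* Let $\mathbb{K}$ be a field and $n,m\in\mathbb{N}$. Given the coefficients of a bivariate polynomial $p\in\mathbb{K}[X,Y]$ with $\deg_X(p)<n$ and $\deg_Y(p)<m$, and of univariate polynomials $g,f\in\mathbb{K}[X]$ of degree less than $nm$ (with $f\neq 0$), the coefficients of $p\big(X,g(X)\big)\operatorname{rem} f(X)$ can be computed with $\mathcal{O}^{\approx}\big(n\,m^{\omega_2/2}\big)$ arithmetic operations in $\mathbb{K}$.
   Context: For $h,f\in\mathbb{K}[X]$ with $f\ne 0$, $h\operatorname{rem} f$ denotes the remainder of $h$ upon division by $f$ (the unique $r$ with $\deg r<\deg f$ and $f\mid h-r$). Complexity counts arithmetic operations in $\mathbb{K}$. The notation $\mathcal{O}^{\approx}(F)$ means $\bigcap_{\epsilon>0}\mathcal{O}(F^{1+\epsilon})$. For reals $r,s,t>0$, $\omega(r,s,t)$ denotes the infimum of all reals $\tau$ such that the product of a $\lceil \nu^r\rceil\times\lceil \nu^s\rceil$ matrix by a $\lceil \nu^s\rceil\times\lceil \nu^t\rceil$ matrix over $\mathbb{K}$ can be computed with $\mathcal{O}(\nu^\tau)$ arithmetic operations in $\mathbb{K}$; $\omega_2:=\omega(1,1,2)$. *)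

(* Defs.v *)
From mathcomp Require Import all_boot all_order all_algebra.
From mathcomp Require Import boolp classical_sets reals exp.

Set Implicit Arguments.
Unset Strict Implicit.
Unset Printing Implicit Defensive.
Import Order.TTheory GRing.Theory Num.Theory.
Local Open Scope ring_scope.
Local Open Scope classical_set_scope.

(* The model of computation: straight-line programs over K with zero tests.
   A program works on a growing list of registers that initially holds the
   inputs; each instruction appends its result as a new register, and operands
   are register indices.  [IfZero t i j] yields register i if register t holds
   zero and register j otherwise: [%%] needs the (data-dependent) degree of the
   divisor.  There are no jumps: over a finite field, a decision tree could read
   off its whole input and return tabulated constants. *)
Inductive instr (K : Type) : Type :=
| Const of K
| Add of nat & nat
| Sub of nat & nat
| Mul of nat & nat
| Div of nat & nat
| IfZero of nat & nat & nat.
Arguments Add {K}.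
Arguments Sub {K}.
Arguments Mul {K}.
Arguments Div {K}.
Arguments IfZero {K}.

Record slp (K : Type) := Slp { code : seq (instr K); outputs : seq nat }.

(* Every instruction has unit cost, constants and zero tests included.  An
   instruction has at most three operands, so that useful constants contribute
   at most a constant factor. *)
Definition cost (K : Type) (P : slp K) : nat := size (code P).

Section Semantics.
Variable K : fieldType.
Implicit Types e : seq K.

(* [None] signals an invalid register index or a division by zero; note that
   the library's x / 0 would silently be 0. *)
Definition eval_instr e (c : instr K) : option K :=
  match c with
  | Const a => Some a
  | Add i j => if (onth e i, onth e j) is (Some x, Some y)
               then Some (x + y) else None
  | Sub i j => if (onth e i, onth e j) is (Some x, Some y)
               then Some (x - y) else None
  | Mul i j => if (onth e i, onth e j) is (Some x, Some y)
               then Some (x * y) else None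
  | Div i j => if (onth e i, onth e j) is (Some x, Some y)
               then (if y == 0 then None else Some (x / y)) else None
  | IfZero t i j =>
      if (onth e t, onth e i, onth e j) is (Some z, Some x, Some y)
      then Some (if z == 0 then x else y) else None
  end.

Fixpoint exec e (cs : seq (instr K)) : option (seq K) :=
  if cs is c :: cs' then
    if eval_instr e c is Some v then exec (rcons e v) cs' else None
  else Some e.

Definition run (P : slp K) (inputs : seq K) : option (seq K) :=
  if exec inputs (code P) is Some e then
    if all (fun i => i < size e)%N (outputs P)
    then Some [seq e`_i | i <- outputs P] else None
  else None.

(* Input and output formats. *)

Definition coefs (N : nat) (q : {poly K}) : seq K := mkseq (fun i => q`_i) N.

(* Elements of {poly {poly K}} are read as bivariate polynomials whose inner
   variable is X and whose outer variable is Y. *)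
Definition bicoefs (n m : nat) (p : {poly {poly K}}) : seq K :=
  flatten (mkseq (fun j => coefs n p`_j) m).

Definition entries (a b : nat) (A : 'M[K]_(a, b)) : seq K :=
  [seq A i j | i <- enum 'I_a, j <- enum 'I_b].

Definition computes_mulmx (a b c : nat) (P : slp K) : Prop :=
  forall (A : 'M[K]_(a, b)) (B : 'M[K]_(b, c)),
    run P (entries A ++ entries B) = Some (entries (A *m B)).

Definition computes_comp_rem (n m : nat) (P : slp K) : Prop :=
  forall (p : {poly {poly K}}) (g f : {poly K}),
    (forall j, (size (p`_j)%R <= n)%N) -> (size p <= m)%N ->
    (size g <= n * m)%N -> (size f <= n * m)%N -> f != 0 ->
    run P (bicoefs n m p ++ coefs (n * m) g ++ coefs (n * m) f)
    = Some (coefs (n * m) (p.[g] %% f)).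

End Semantics.

Section Asymptotics.
Variable R : realType.

(* The bound is uniform in all indices, for one as well as for several
   asymptotic parameters. *)
Definition bigOh (I : Type) (F : I -> R) : set (I -> R) :=
  [set T | exists C : R, forall i, `|T i| <= C * F i].

Definition soft_bigOh (I : Type) (F : I -> R) : set (I -> R) :=
  \bigcap_(eps in [set eps : R | 0 < eps])
    bigOh (fun i => F i `^ (1 + eps)).

Definition ceil_pow (nu : nat) (r : R) : nat := `|Num.ceil (nu%:R `^ r)|%N.

(* Intended for r, s, t > 0.  Then the set is nonempty and bounded below, so
   that [inf] is a genuine infimum. *)
Definition omega (K : fieldType) (r s t : R) : R :=
  inf [set tau : R | exists P : nat -> slp K,
    (forall nu, computes_mulmx (ceil_pow nu r) (ceil_pow nu s) (ceil_pow nu t) (P nu)) /\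
    bigOh (fun nu : nat => nu%:R `^ tau) (fun nu => (cost (P nu))%:R)].

Definition omega2 (K : fieldType) : R := omega K 1 1 2.

End Asymptotics.

(* Main.v *)
(** The straight-line programs of this model are not uniform in [(n, m)], so a
    family of programs of minimal cost meets the bound for every [eps] as soon
    as, for each [eps], some family does.

    Write [N = n m] and let [l] be about [sqrt m].  The powers
    [h_k = g^k rem f], [k <= l], are cut into [l^2] blocks of [n] coefficients,
    and [p] into [l] slices of [l] coefficients in [Y]; the values of the slices
    at [g] are then read off an [l x l] by [l x l^2] matrix product over
    polynomials of degree less than [n], and Horner's rule in [g^l rem f]
    combines them.

    Toom's recursion multiplies matrices of polynomials of degree less than
    [n] with [n^(1+eps)] matrix products over [K].  It rests on a decomposition
    of the multiplication of polynomials with [k] coefficients into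
    [r <= k^(1+eps)] products, obtained by interpolation, over an iterated
    quadratic extension when [K] has too few elements.

    For remainders, [X^(N - size f)] has as coefficients the indicators of the
    possible values of [size f], so [f] can be normalized to a fixed degree by a
    polynomial product; Newton's iteration then inverts its reversal.

    Finally [omega2 >= 3], because a program for an [l x l] by [l x l^2] product
    computes [l^3] distinct entries; hence the [O(l)] operations modulo [f] are
    within the bound. *)
Require Import Defs.
From mathcomp Require Import all_boot all_order all_algebra all_field.
From mathcomp Require Import boolp classical_sets reals exp.
From mathcomp Require Import zify ring lra.
Set Implicit Arguments.
Unset Strict Implicit.
Unset Printing Implicit Defensive.
Import Order.TTheory GRing.Theory Num.Theory.
Local Open Scope ring_scope.
Local Open Scope classical_set_scope.

(** * Circuits *)

Section Computable.
Variables (K : fieldType) (S : Type).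
Local Notation fn := (S -> K).
Implicit Types (B T : set fn) (c : nat) (x y v : fn).

Definition csts : set fn := range (fun (a : K) (_ : S) => a).

Inductive step B : fn -> Prop :=
| StepAdd x y of B x & B y : step B (fun s => x s + y s)
| StepSub x y of B x & B y : step B (fun s => x s - y s)
| StepMul x y of B x & B y : step B (fun s => x s * y s)
| StepDiv x y of B x & B y & (forall s, y s != 0) : step B (fun s => x s / y s)
| StepIf t x y of B t & B x & B y :
    step B (fun s => if t s == 0 then x s else y s).

(* A circuit model without register indices: the functions [T] of an abstract
   input [s : S] can be obtained from those in [B] by at most [c] operations,
   where constants are free. *)
Inductive computable B : nat -> set fn -> Prop :=
| ComputableDone c T of T `<=` B `|` csts : computable B c T
| ComputableStep c T v of step (B `|` csts) v & computable (B `|` [set v]) c T :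
    computable B c.+1 T.

Lemma csts_cst (a : K) : csts (fun _ => a).
Proof. by exists a. Qed.

Lemma step_sub B B' v : B `<=` B' -> step B v -> step B' v.
Proof. by move=> sB; case; intros; constructor; auto. Qed.

Lemma computable_sub B B' c c' T T' :
  B `<=` B' `|` csts -> (c <= c')%N -> T' `<=` T ->
  computable B c T -> computable B' c' T'.
Proof.
move=> + + + cT; elim: cT B' c' T' => {B c T} [B c T sT|B c T v sv _ IH] B' c' T' sB lec sT'.
  by constructor=> x /sT' /sT [/sB|]; [|right].
case: c' lec => // c' lec; apply: (@ComputableStep _ _ _ v).
  by apply: step_sub sv => x [/sB|]; [|right].
by apply: IH => // x [/sB [|]|->]; [left; left|right|left; right].
Qed.

Lemma computable_subl B B' c T :
  B `<=` B' `|` csts -> computable B c T -> computable B' c T.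
Proof. by move=> sB; apply: computable_sub. Qed.

Lemma computable_subr B c T T' :
  T' `<=` T -> computable B c T -> computable B c T'.
Proof. by move=> sT; apply: computable_sub. Qed.

Lemma computable_trans B c1 c2 T1 T2 :
  computable B c1 T1 -> computable (B `|` T1) c2 T2 ->
  computable B (c1 + c2) T2.
Proof.
move=> cT; elim: cT c2 T2 => {B c1 T1} [B c T sT|B c T v sv _ IH] c2 T2 cT2.
  apply: computable_sub cT2; rewrite ?leq_addl // => x [|/sT //]; by left.
rewrite addSn; apply: (ComputableStep sv); apply: IH.
by apply: computable_sub cT2 => // x [|]; left; [left; left|right].
Qed.

Lemma computable_keep B c T : computable B c T -> computable B c (B `|` T).
Proof.
elim=> {B c T} [B c T sT|B c T v sv _ IH]; first by constructor=> x [|/sT]; [left|].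
apply: (ComputableStep sv); apply: computable_sub IH => // x [|]; first by left; left.
by right.
Qed.

Lemma computableU B c1 c2 T1 T2 :
  computable B c1 T1 -> computable (B `|` T1) c2 T2 ->
  computable B (c1 + c2) (T1 `|` T2).
Proof.
move=> c1T /computable_keep c2T; apply: (computable_trans c1T).
by apply: computable_sub c2T => // x [|]; [left; right|right].
Qed.

Lemma computable0 B T : T `<=` B `|` csts -> computable B 0 T.
Proof. exact: ComputableDone. Qed.

Lemma computable1 B v : step (B `|` csts) v -> computable B 1 [set v].
Proof. by move/ComputableStep; apply; constructor=> x ->; left; right. Qed.

Lemma computable_bigcup (I : finType) B c (T : I -> set fn) :
  (forall i, computable B c (T i)) ->
  computable B (#|I| * c) (\bigcup_i T i).
Proof.
move=> cT; suff: computable B (size (enum I) * c)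
    [set v | exists2 i, i \in enum I & T i v].
  rewrite -cardE; apply: computable_sub => //.
  by move=> v [i _ Ti]; exists i => //; rewrite mem_enum.
elim: (enum I) => [|i s IH]; first by constructor=> x [].
rewrite mulSn.
apply: (@computable_sub B _ (c + size s * c) _
            (T i `|` [set v | exists2 i, i \in s & T i v])).
- by move=> x; left.
- by [].
- move=> v [j]; rewrite inE => /orP[/eqP->|js] Tj; first by left.
  by right; exists j.
apply: computableU => //; apply: computable_sub IH => //; by move=> x; left; left.
Qed.

Lemma computable_mem B v : (B `|` csts) v -> computable B 0 [set v].
Proof. by move=> Bv; apply: computable0 => x ->. Qed.

Lemma computable_sum (n : nat) B (a : 'I_n -> K) (x : 'I_n -> fn) :
  (forall i, (B `|` csts) (x i)) ->
  computable B (2 * n) [set fun s => \sum_i a i * x i s].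
Proof.
elim: n a x => [|n IH] a x Bx.
  apply: computable_mem; right; exists 0 => //; apply/funext => s.
  by rewrite big_ord0.
have {IH} := IH (fun i => a (widen_ord (leqnSn n) i))
                (fun i => x (widen_ord (leqnSn n) i)) (fun i => Bx _) => cn.
rewrite mulnS addnC; apply: (computable_trans cn).
set y := fun s => \sum_(i < n) _.
apply: (@ComputableStep _ _ _ (fun s => a ord_max * x ord_max s)).
  by apply: (@StepMul _ (fun _ => a ord_max)); [right; exact: csts_cst|
     case: (Bx ord_max); [left; left|right]].
have -> : (fun s => \sum_(i < n.+1) a i * x i s) =
          (fun s => y s + a ord_max * x ord_max s).
  by apply/funext => s; rewrite big_ord_recr.
apply: computable1; apply: (@StepAdd _ y (fun s => a ord_max * x ord_max s)).
  by left; left; right.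
by left; right.
Qed.

(** * Translation between programs and circuits *)

Definition regs (e : S -> seq K) : set fn := range (fun i s => (e s)`_i).

Lemma computable_exec N (e e' : S -> seq K) (cs : seq (instr K)) :
  (forall s, size (e s) = N) ->
  (forall s, exec (e s) cs = Some (e' s)) ->
  computable (regs e) (size cs) (regs e').
Proof.
elim: cs e N => [|i cs IH] e N szE /= he.
  by apply: computable0; left; have -> : e = e' by apply/funext => s; case: (he s).
have [v hv] : exists v, forall s, eval_instr (e s) i = Some (v s).
  exists (fun s => odflt 0 (eval_instr (e s) i)) => s.
  by move: (he s); case: (eval_instr _ _).
have {he}IH : computable (regs (fun s => rcons (e s) (v s))) (size cs) (regs e').
  apply: (IH _ N.+1) => s; first by rewrite size_rcons szE.
  by rewrite -he hv.
have nthE j s (x : K) : onth (e s) j = Some x -> x = (e s)`_j.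
  by move/(onth_nth 0).
have regE j : (regs e `|` csts) (fun s => (e s)`_j) by left; exists j.
have {}IH : computable (regs e `|` [set v]) (size cs) (regs e').
  apply: computable_sub IH => // _ [j _ <-].
  (* An old register, an index beyond the new register, where [nth] returns the constant zero, or
     the new register itself. The common length [N] makes the case independent of [s]. *)
  have [jN|jN|jN] := ltngtP j N.
  - left; left; exists j => //; apply/funext => s.
    by rewrite nth_rcons szE jN.
  - right; exists 0 => //; apply/funext => s.
    by rewrite nth_default // size_rcons szE.
  - by left; right; apply/funext => s; rewrite nth_rcons szE jN ltnn eqxx.
have [cv|sv] : csts v \/ step (regs e `|` csts) v; last exact: ComputableStep sv IH.
- case: i hv {IH} => [a|j k|j k|j k|j k|t j k] /= hv.
  + by left; exists a => //; apply/funext => s; case: (hv s).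
  + right; have -> : v = fun s => (e s)`_j + (e s)`_k; last exact: StepAdd.
    apply/funext => s; move: (hv s); case ej: (onth _ j) => [x|//].
    by case ek: (onth _ k) => [y|//] [<-]; rewrite (nthE _ _ _ ej) (nthE _ _ _ ek).
  + right; have -> : v = fun s => (e s)`_j - (e s)`_k; last exact: StepSub.
    apply/funext => s; move: (hv s); case ej: (onth _ j) => [x|//].
    by case ek: (onth _ k) => [y|//] [<-]; rewrite (nthE _ _ _ ej) (nthE _ _ _ ek).
  + right; have -> : v = fun s => (e s)`_j * (e s)`_k; last exact: StepMul.
    apply/funext => s; move: (hv s); case ej: (onth _ j) => [x|//].
    by case ek: (onth _ k) => [y|//] [<-]; rewrite (nthE _ _ _ ej) (nthE _ _ _ ek).
  + have {}hv s : (e s)`_k != 0 /\ v s = (e s)`_j / (e s)`_k.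
      move: (hv s); case ej: (onth _ j) => [x|//]; case ek: (onth _ k) => [y|//].
      rewrite (nthE _ _ _ ej) (nthE _ _ _ ek); by case: eqP => // _ [<-].
    right; have -> : v = fun s => (e s)`_j / (e s)`_k.
      by apply/funext => s; case: (hv s).
    by apply: StepDiv => // s; case: (hv s).
  + right; have -> : v = fun s => if (e s)`_t == 0 then (e s)`_j else (e s)`_k.
      apply/funext => s; move: (hv s); case et: (onth _ t) => [z|//].
      case ej: (onth _ j) => [x|//]; case ek: (onth _ k) => [y|//] [<-].
      by rewrite (nthE _ _ _ et) (nthE _ _ _ ej) (nthE _ _ _ ek).
    exact: (@StepIf _ (fun s => (e s)`_t)).
- by apply: computable_sub IH => // x [|->]; [left|right].
Qed.

Lemma computable_run N (inp out : S -> seq K) (P : slp K) :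
  (forall s, size (inp s) = N) -> (forall s, run P (inp s) = Some (out s)) ->
  computable (regs inp) (cost P) (regs out).
Proof.
move=> szI hr; have [e he] : exists e, forall s, exec (inp s) (code P) = Some (e s).
  exists (fun s => odflt [::] (exec (inp s) (code P))) => s.
  by move: (hr s); rewrite /run; case: (exec _ _).
have outE s : out s = [seq (e s)`_i | i <- outputs P].
  by move: (hr s); rewrite /run he; case: ifP => // _ [<-].
rewrite -[cost P]addn0; apply: computable_trans (computable_exec szI he) _.
apply: computable0 => _ [i _ <-].
have [szi|szi] := ltnP i (size (outputs P)).
  left; right; exists (nth 0%N (outputs P) i) => //; apply/funext => s.
  by rewrite outE (nth_map 0%N).
by right; exists 0 => //; apply/funext => s; rewrite nth_default // outE size_map.
Qed.

(* Constants cost an instruction of an [slp], but a step has at most three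
   operands, whence the factor [4]. *)
Lemma slp_of_computable B c (inp outs : seq fn) :
  B `<=` [set v | exists i, onth inp i = Some v] ->
  computable B c [set v | exists i, onth outs i = Some v] ->
  exists P : slp K, (cost P <= 4 * c + size outs)%N /\
    forall s, run P [seq v s | v <- inp] = Some [seq v s | v <- outs].
Proof.
pose fetch (l : seq fn) (v : fn) := exists i, onth l i = Some v.
pose ext l n l' := exists2 cs : seq (instr K), (size cs <= n)%N & 
  (forall s, exec [seq v s | v <- l] cs = Some [seq v s | v <- l']).
have fetch_rcons l v w : fetch l w -> fetch (rcons l v) w.
  case=> i hi; exists i; rewrite -cats1 onth_cat.
  by case: ltnP => // /onth_default; rewrite hi.
have fetch_last l v : fetch (rcons l v) v.
  by exists (size l); rewrite -cats1 onth_cat ltnn subnn.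
have ext_trans l1 l2 l3 n1 n2 : ext l1 n1 l2 -> ext l2 n2 l3 -> ext l1 (n1 + n2)%N l3.
  case=> cs1 sz1 e1 [cs2 sz2 e2]; exists (cs1 ++ cs2).
    by rewrite size_cat leq_add.
  have exec_cat e cs cs' : exec e (cs ++ cs') = obind (fun e' => exec e' cs') (exec e cs).
    by elim: cs e => //= i cs IH e; case: eval_instr.
  by move=> s; rewrite exec_cat e1 /= e2.
have onthE l s i v : onth l i = Some v -> onth [seq v s | v <- l] i = Some (v s).
  by move=> h; rewrite onth_map h.
have ext_step l i v : (forall s, eval_instr [seq v s | v <- l] i = Some (v s)) ->
    ext l 1 (rcons l v).
  by move=> hi; exists [:: i] => //= s; rewrite hi map_rcons.
have ext_cst l v : fetch l v \/ csts v ->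
    exists l', [/\ ext l 1 l', forall w, fetch l w -> fetch l' w & fetch l' v].
  case=> [lv|[a _ <-]]; first by exists l; split=> //; exists [::].
  exists (rcons l (fun _ => a)); split=> //; last by move=> w; exact: fetch_rcons.
  exact: (ext_step _ (Const a)).
have ext_csts l v1 v2 v3 :
    (fetch l `|` csts) v1 -> (fetch l `|` csts) v2 -> (fetch l `|` csts) v3 ->
    exists l', [/\ ext l 3 l', forall w, fetch l w -> fetch l' w,
                fetch l' v1, fetch l' v2 & fetch l' v3].
  move=> h1 h2 h3; have [l1 [e1 m1 f1]] := ext_cst _ _ h1.
  have [|l2 [e2 m2 f2]] := ext_cst l1 v2; first by case: h2; [left; auto|right].
  have [|l3 [e3 m3 f3]] := ext_cst l2 v3; first by case: h3; [left; auto|right].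
  exists l3; split; auto; exact: ext_trans e1 (ext_trans _ _ _ 1%N 1%N e2 e3).
have ext_comp c' B' T : computable B' c' T -> forall l, B' `<=` fetch l ->
    exists l', [/\ ext l (4 * c')%N l', forall w, fetch l w -> fetch l' w
                 & T `<=` fetch l' `|` csts].
  elim=> {B' c' T} [B' c' T sT|B' c' T v sv _ IH] l sB.
    exists l; split=> //; first by exists [::].
    by move=> v /sT [/sB|]; [left|right].
  suff [l1 [e1 m1 f1]] : exists l', [/\ ext l 4 l', forall w, fetch l w -> fetch l' w
      & fetch l' v].
    have [|l2 [e2 m2 f2]] := IH l1; first by move=> w [/sB/m1|->].
    exists l2; split=> [|w /m1/m2 //|//]; rewrite mulnS; exact: ext_trans e1 e2.
  have sBc w : (B' `|` csts) w -> (fetch l `|` csts) w.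
    by case=> [/sB|]; [left|right].
  (* Zero fills the third place of binary operations: each step loads up to three constants and
     performs one operation, hence four instructions. *)
  have zc : (fetch l `|` csts) (fun _ => 0) by right; exists 0.
  have fin l1 i w : ext l 3 l1 -> (forall w, fetch l w -> fetch l1 w) ->
      (forall s, eval_instr [seq v s | v <- l1] i = Some (w s)) ->
      exists l', [/\ ext l 4 l', forall w, fetch l w -> fetch l' w & fetch l' w].
    move=> e1 m1 hi; exists (rcons l1 w); split=> //; last by move=> u /m1; exact: fetch_rcons.
    exact: ext_trans _ _ _ 3%N 1%N e1 (ext_step _ _ _ hi).
  case: sv => [x y|x y|x y|x y|t x y] /sBc hx /sBc hy.
  - have [l1 [e1 m1 [i hi] [j hj] _]] := ext_csts _ _ _ _ hx hy zc.
    by apply: (fin l1 (Add i j)) => //= s; rewrite (onthE _ _ _ _ hi) (onthE _ _ _ _ hj).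
  - have [l1 [e1 m1 [i hi] [j hj] _]] := ext_csts _ _ _ _ hx hy zc.
    by apply: (fin l1 (Defs.Sub i j)) => //= s; rewrite (onthE _ _ _ _ hi) (onthE _ _ _ _ hj).
  - have [l1 [e1 m1 [i hi] [j hj] _]] := ext_csts _ _ _ _ hx hy zc.
    by apply: (fin l1 (Mul i j)) => //= s; rewrite (onthE _ _ _ _ hi) (onthE _ _ _ _ hj).
  - move=> ynz; have [l1 [e1 m1 [i hi] [j hj] _]] := ext_csts _ _ _ _ hx hy zc.
    apply: (fin l1 (Div i j)) => //= s; rewrite (onthE _ _ _ _ hi) (onthE _ _ _ _ hj).
    by rewrite (negPf (ynz s)).
  - move=> /sBc hz; have [l1 [e1 m1 [k hk] [i hi] [j hj]]] := ext_csts _ _ _ _ hx hy hz.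
    apply: (fin l1 (IfZero k i j)) => //= s.
    by rewrite (onthE _ _ _ _ hi) (onthE _ _ _ _ hj) (onthE _ _ _ _ hk).
move=> sB /ext_comp /(_ inp sB) [l1 [e1 _ s1]].
(* An output may be a constant that no register holds yet; loading these takes at most [size outs]
   instructions. *)
have [l2 [e2 _ s2]] : exists l2, [/\ ext l1 (size outs) l2,
    forall w, fetch l1 w -> fetch l2 w & fetch outs `<=` fetch l2].
  elim: outs l1 {e1} s1 => [|v outs IH] l1 s1.
    by exists l1; split=> //; [exists [::]|move=> v []; case].
  have [|l2 [e2 m2 f2]] := ext_cst l1 v; first by apply: s1; exists 0%N.
  have [|l3 [e3 m3 s3]] := IH l2.
    by move=> w [i hi]; case: (s1 w); [exists i.+1|left; auto|right].
  exists l3; split; first exact: ext_trans _ _ _ 1%N _ e2 e3.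
    by auto.
  by move=> w [[|i] /= hi]; [case: hi => <-; auto|apply: s3; exists i].
have [idx hall hidx] : exists2 idx, all (fun i => i < size l2)%N idx &
    forall s, [seq [seq v s | v <- l2]`_i | i <- idx] = [seq v s | v <- outs].
  elim: outs s2 {e2 s1} => [|v outs IH] s2; first by exists [::].
  have [|idx hall hidx] := IH; first by move=> w [i hi]; apply: s2; exists i.+1.
  have [|i hi] := s2 v; first by exists 0%N.
  exists (i :: idx) => /= [|s]; first by rewrite -onthTE hi.
  by rewrite /= hidx; congr (_ :: _); apply: onth_nth; exact: onthE hi.
have [cs szcs ecs] := ext_trans _ _ _ _ _ e1 e2.
exists (Slp cs idx); split=> // s; rewrite /run /= ecs size_map hall.
by rewrite hidx.
Qed.

End Computable.
Arguments csts {K S}.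

(** * The rank of polynomial multiplication *)

(* A decomposition, indexed by [I], of the tensor of multiplication of
   polynomials with [k] coefficients into rank one tensors. *)
Definition polymul_decomp (K : fieldType) (k : nat) (I : finType) : Prop :=
  exists u v w : I -> nat -> K,
    forall i j l, (i < k)%N -> (j < k)%N -> (l < 2 * k)%N ->
      \sum_rho u rho i * v rho j * w rho l = (i + j == l)%N%:R.

(* Evaluation at the points of [s], then interpolation. *)
Lemma polymul_decomp_points (K : fieldType) (k : nat) (s : seq K) :
  uniq s -> size s = (2 * k)%N -> polymul_decomp K k 'I_(2 * k).
Proof.
move=> us szs; pose x : 'rV[K]_(2 * k) := \row_r s`_r.
pose V := Vandermonde (2 * k) x.
have Vu : V \in unitmx.
  rewrite unitmxE det_Vandermonde unitfE; apply/prodf_neq0 => i _.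
  apply/prodf_neq0 => j ltij; rewrite !mxE subr_eq0 nth_uniq ?szs //.
  by apply: contraTneq ltij => ->; rewrite ltnn.
exists (fun (r : 'I_(2 * k)) i => s`_r ^+ i), (fun (r : 'I_(2 * k)) i => s`_r ^+ i),
  (fun r l => if insub l is Some l' then invmx V r l' else 0).
move=> i j l ik jk lk; have ijk : (i + j < 2 * k)%N by lia.
have := congr1 (fun M : 'M_(2 * k) => M (Ordinal ijk) (Ordinal lk)) (mulmxV Vu).
rewrite !mxE -val_eqE /= => <-; apply: eq_bigr => r _; rewrite insubT !mxE.
by rewrite exprD.
Qed.

(** Write [u] and [v] in a [K]-basis of [L], leave the basis vectors to [w], and apply a [K]-linear
    form [phi] with [phi 1 = 1], which fixes the values 0 and 1 on the right. Every product over [L]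
    becomes one product over [K] per pair of coordinates. *)
Lemma polymul_decomp_ext (K : fieldType) (L : fieldExtType K) (k : nat) (I : finType) :
  polymul_decomp L k I ->
  polymul_decomp K k (I * ('I_(\dim {:L}) * 'I_(\dim {:L})))%type.
Proof.
case=> [u [v [w uvw]]]; set d := \dim {:L}.
have [phi [phi1 phiZ phi_sum]] : exists phi : L -> K,
    [/\ phi 1 = 1, forall a z, phi (a *: z) = a * phi z &
      forall (J : finType) (F : J -> L), phi (\sum_r F r) = \sum_r phi (F r)].
  have b1 : (1 : L) = \sum_(i < d) coord (vbasis {:L}) i 1 *: (vbasis {:L})`_i.
    by apply: coord_vbasis; rewrite memvf.
  have [i0 hi0] : exists i : 'I_d, coord (vbasis {:L}) i 1 != 0.
    apply/existsP; apply: contraT; rewrite negb_exists => /forallP h.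
    have /eqP := b1; rewrite big1 ?oner_eq0 // => i _.
    by have := h i; rewrite negbK => /eqP ->; rewrite scale0r.
  pose c := (coord (vbasis {:L}) i0 1)^-1.
  exists (fun z => c * coord (vbasis {:L}) i0 z); split=> [|a z|J F].
  - by rewrite /c mulVf.
  - by rewrite linearZ mulrCA.
  - by rewrite linear_sum mulr_sumr.
pose b (i : 'I_d) := (vbasis {:L})`_i.
have cb (z : L) : z = \sum_(i < d) coord (vbasis {:L}) i z *: b i.
  by apply: coord_vbasis; rewrite memvf.
exists (fun r i => coord (vbasis {:L}) r.2.1 (u r.1 i)),
  (fun r j => coord (vbasis {:L}) r.2.2 (v r.1 j)),
  (fun r l => phi (b r.2.1 * b r.2.2 * w r.1 l)).
move=> i j l ik jk lk; have := congr1 phi (uvw _ _ _ ik jk lk).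
have -> : phi (i + j == l)%N%:R = (i + j == l)%N%:R.
  have phi0 : phi 0 = 0 by rewrite -{1}(scale0r 1) phiZ mul0r.
  by case: (_ == _).
move=> <-; rewrite phi_sum [RHS](eq_bigr (fun r => \sum_p
   coord (vbasis {:L}) p.1 (u r i) * coord (vbasis {:L}) p.2 (v r j) * 
   phi (b p.1 * b p.2 * w r l))); last first.
  move=> r _; rewrite {1}(cb (u r i)) {1}(cb (v r j)).
  rewrite big_distrlr /= pair_big /= mulr_suml phi_sum; apply: eq_bigr => p _.
  by rewrite -scalerAl -scalerAr scalerA -scalerAl phiZ.
by rewrite pair_big.
Qed.

(** The list [s] makes [K] finite. The map [x (x + 1)] vanishes at both 0 and -1, so it is not
    injective, hence not surjective: it misses some [c], and [X (X + 1) - c] is irreducible. This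
    works in every characteristic. *)
Lemma quadratic_ext (K : fieldType) (s : seq K) :
  (forall x, x \in s) -> exists L : fieldExtType K, \dim {:L} = 2%N.
Proof.
move=> sK; pose t := undup s.
have tK x : x \in t by rewrite mem_undup.
have [c hc] : exists c : K, forall x, x * (x + 1) != c.
  apply: contrapT => /forallNP h.
  have h' c : exists x : K, x * (x + 1) = c.
    apply: contrapT => hc; apply: (h c) => x; apply/eqP => xc; by apply: hc; exists x.
  have us : uniq [seq x * (x + 1) | x <- t].
    apply: (leq_size_uniq (undup_uniq s)); last by rewrite size_map.
    by move=> c _; have [x <-] := h' c; apply/mapP; exists x.
  have /uniqP inj := us.
  have ut : uniq t := undup_uniq s.
  have := inj 0 (index 0 t) (index (-1) t).
  rewrite !inE size_map !index_mem => /(_ (tK _) (tK _)).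
  rewrite !(nth_map 0) ?index_mem // !nth_index // mul0r addNr mulr0 => /(_ erefl).
  move/(congr1 (nth 0 t)); rewrite !nth_index // => /eqP.
  by rewrite eq_sym oppr_eq0 oner_eq0.
pose p : {poly K} := ('X + 1%:P) * 'X - c%:P.
have szp : size p = 3%N.
  have sz1 : size (('X + 1%:P : {poly K}) * 'X) = 3%N.
    by rewrite size_mulX ?size_XaddC // -size_poly_eq0 size_XaddC.
  rewrite size_polyDl ?sz1 // size_polyN; exact: leq_ltn_trans (size_polyC_leq1 _) _.
have [|L dimL _] := @irredp_FAdjoin K p; last by exists L; rewrite dimL szp.
apply: cubic_irreducible => [|x]; first by rewrite szp.
by rewrite rootE /p !hornerE subr_eq0 mulrC hc.
Qed.

Definition has_elements (K : fieldType) (N : nat) := exists2 s : seq K, uniq s & size s = N.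

Lemma has_elements_leq (K : fieldType) N N' : (N <= N')%N -> has_elements K N' -> has_elements K N.
Proof.
move=> le [s us szs]; exists (take N s); first exact: take_uniq.
by rewrite size_take szs; case: ltngtP le.
Qed.

Lemma has_elements_ext (K : fieldType) (L : fieldExtType K) N :
  \dim {:L} = 2%N -> has_elements K N -> has_elements L (N * N).
Proof.
move=> dimL [s us szs]; have lt0 : (0 < \dim {:L})%N by rewrite dimL.
have lt1 : (1 < \dim {:L})%N by rewrite dimL.
pose b i := (vbasis {:L})`_i.
exists [seq x *: b 0%N + y *: b 1%N | x <- s, y <- s]; last by rewrite size_allpairs szs.
apply: allpairs_uniq => // -[x y] [x' y'] _ _ /= exy.
have fb : free (vbasis {:L}) := basis_free (vbasisP _).
have coordE x1 y1 (i : 'I_(\dim {:L})) : coord (vbasis {:L}) i (x1 *: b 0%N + y1 *: b 1%N) =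
    x1 * (i == 0%N :> nat)%:R + y1 * (i == 1%N :> nat)%:R.
  rewrite linearD !linearZ /=.
  congr (_ * _ + _ * _); rewrite eq_sym.
    exact: coord_free (Ordinal lt0) i fb.
  exact: coord_free (Ordinal lt1) i fb.
have := congr1 (coord (vbasis {:L}) (Ordinal lt0)) exy.
have := congr1 (coord (vbasis {:L}) (Ordinal lt1)) exy.
by rewrite !coordE /= !mulr0 !mulr1 !add0r !addr0 => -> ->.
Qed.

(* Over a field with too few points, climb a tower of quadratic extensions. *)
Lemma polymul_decomp_tower (b : nat) (K : fieldType) (N k : nat) :
  has_elements K N -> (0 < k)%N -> (2 * k <= N ^ (2 ^ b))%N ->
  exists2 I : finType, polymul_decomp K k I & (2 * k <= #|I| <= 2 * k * 4 ^ b)%N.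
Proof.
move=> + k0; elim: b K N => [|b IH] K N KN leN.
  have [s us szs] := has_elements_leq leN KN.
  exists 'I_(2 * k); first exact: polymul_decomp_points szs.
  by rewrite card_ord leqnn muln1 leqnn.
have [[s us szs]|noK] := EM (has_elements K (2 * k)).
  exists 'I_(2 * k); first exact: polymul_decomp_points szs.
  by rewrite card_ord leqnn leq_pmulr // expn_gt0.
(* Without [2 * k] distinct elements the field is finite. A quadratic extension squares the number
   of available points and multiplies the rank by 4. *)
have [s sK] : exists s : seq K, forall x, x \in s.
  apply: contrapT => /forallNP h; apply: noK.
  elim: (2 * k)%N => [|j [s us szs]]; first by exists [::].
  have /existsNP [x /negP xs] := h s.
  by exists (x :: s); rewrite /= ?xs ?szs.
have [L dimL] := quadratic_ext sK.
have [|I dI /andP[cI1 cI2]] := IH L (N * N)%N (has_elements_ext dimL KN).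
  by rewrite mulnn -expnM -expnS.
have := polymul_decomp_ext dI; rewrite dimL => dI'.
eexists; first exact: dI'.
rewrite !card_prod !card_ord expnSr; apply/andP; split.
  by apply: leq_trans cI1 _; apply: leq_pmulr.
by rewrite [leqRHS]mulnA leq_mul.
Qed.

(** From the two points 0 and 1, squaring the number of points [b] times leads to [2 ^ (2 ^ b)],
    which is exactly [2 * k]. *)
Lemma polymul_decomp_exists (K : fieldType) (b : nat) (k := (2 ^ (2 ^ b).-1)%N) :
  exists2 I : finType, polymul_decomp K k I & (2 * k <= #|I| <= 2 * k * 4 ^ b)%N.
Proof.
apply: (@polymul_decomp_tower b K 2).
- by exists [:: 0; 1] => //=; rewrite inE eq_sym oner_eq0.
- by rewrite expn_gt0.
- by rewrite -expnS prednK // expn_gt0.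
Qed.

(** * Toom's recursion for matrices of polynomials *)

Section Blocks.
Variable R : nzRingType.
Implicit Types p q : {poly R}.

Definition blk (n t : nat) p : {poly R} := \poly_(u < n) p`_(t * n + u)%N.

Lemma size_blk n t p : (size (blk n t p) <= n)%N.
Proof. exact: size_poly. Qed.

(** Shifted by multiples of [n], polynomials with at most [n] coefficients do not overlap, so
    nothing has to be added. *)
Lemma coef_concat (n T : nat) (c : nat -> {poly R}) (u : nat) : (0 < n)%N ->
  (forall t, (size (c t) <= n)%N) ->
  (\sum_(t < T) c t * 'X^(t * n))`_u =
    if (u %/ n < T)%N then (c (u %/ n)%N)`_(u %% n)%N else 0.
Proof.
move=> n0 szc; rewrite coef_sum.
have zero (t : nat) : t != (u %/ n)%N -> (c t * 'X^(t * n))`_u = 0.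
  rewrite coefMXn neq_ltn => /orP[lt|gt]; case: ltnP => // le.
    rewrite nth_default // (leq_trans (szc t)) // leq_subRL //.
    by rewrite addnC -mulSn (leq_trans _ (leq_divM u n)) // leq_mul2r lt orbT.
  by move: gt; rewrite ltn_divLR // ltnNge le.
case: ltnP => ltT.
  rewrite (bigD1 (Ordinal ltT)) //= big1 ?addr0 => [|t tn]; last exact: zero.
  rewrite coefMXn ltnNge leq_divM /=; congr (_`_ _).
  by rewrite {1}(divn_eq u n) addKn.
by rewrite big1 // => t _; apply: zero; rewrite neq_ltn (leq_trans (ltn_ord t) ltT).
Qed.

Lemma sum_blk (n T : nat) p : (0 < n)%N -> (size p <= T * n)%N ->
  p = \sum_(t < T) blk n t p * 'X^(t * n).
Proof.
move=> n0 szp; apply/polyP => u.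
rewrite (@coef_concat n T (fun t => blk n t p)) // => [|t]; last exact: size_blk.
rewrite coef_poly ltn_mod n0 -divn_eq; case: ltnP => // leT.
by rewrite nth_default // (leq_trans szp) // -leq_divRL.
Qed.

End Blocks.

(** * Circuits for products of polynomial matrices *)

Section Mxmul.
Variable K : fieldType.

Definition polyset (S : Type) (p : S -> {poly K}) : set (S -> K) :=
  range (fun i s => (p s)`_i).

Definition mxset (S : Type) (a b : nat) (A : S -> 'M[{poly K}]_(a, b)) :
  set (S -> K) := \bigcup_i \bigcup_j polyset (fun s => A s i j).

(** Quantifying over [S], [A] and [B] turns the product into a subroutine that fits into circuits on
    arbitrary inputs. *)
Definition mxmul_cost (a b c N M : nat) : Prop :=
  forall (S : Type) (A : S -> 'M[{poly K}]_(a, b)) (B : S -> 'M[{poly K}]_(b, c)),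
    (forall s i j, (size (A s i j) <= N)%N) ->
    (forall s i j, (size (B s i j) <= N)%N) ->
    computable (mxset A `|` mxset B) M (mxset (fun s => A s *m B s)).

Section Sets.
Variable S : Type.
Implicit Types (B : set (S -> K)) (p q : S -> {poly K}).

Lemma polyset_coef p i : polyset p (fun s => (p s)`_i).
Proof. by exists i. Qed.

Lemma mxset_coef (a b : nat) (A : S -> 'M[{poly K}]_(a, b)) i j l :
  mxset A (fun s => (A s i j)`_l).
Proof. by exists i => //; exists j => //; exists l. Qed.

Lemma computable_polyset B c N p : (forall s, (size (p s) <= N)%N) ->
  (forall i, (i < N)%N -> computable B c [set fun s => (p s)`_i]) ->
  computable B (N * c) (polyset p).
Proof.
move=> szp cp; have := computable_bigcup (fun i : 'I_N => cp i (ltn_ord i)).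
move=> /computable_trans - /(_ 0%N (polyset p)); rewrite card_ord addn0; apply.
apply: computable0 => _ [i _ <-]; have [iN|iN] := ltnP i N.
  by left; right; exists (Ordinal iN).
by right; exists 0 => //; apply/funext => s; rewrite nth_default // (leq_trans (szp s)).
Qed.

Lemma computable_mxset a b B c N (A : S -> 'M[{poly K}]_(a, b)) :
  (forall s i j, (size (A s i j) <= N)%N) ->
  (forall i j l, (l < N)%N -> computable B c [set fun s => (A s i j)`_l]) ->
  computable B (a * b * N * c) (mxset A).
Proof.
move=> szA cA.
have cij (ij : 'I_a * 'I_b) : computable B (N * c) (polyset (fun s => A s ij.1 ij.2)).
  by apply: computable_polyset => // i iN; exact: cA.
have := computable_bigcup cij; rewrite card_prod !card_ord mulnA.
by apply: computable_sub => // x [i _ [j _ ?]]; exists (i, j).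
Qed.

Lemma computable_sum_fin (J : finType) B (a : J -> K) (x : J -> S -> K) :
  (forall j, (B `|` csts) (x j)) ->
  computable B (2 * #|J|) [set fun s => \sum_j a j * x j s].
Proof.
move=> Bx; have := computable_sum (fun i : 'I_#|J| => a (enum_val i)) (fun i => Bx (enum_val i)).
apply: computable_sub => // _ ->; apply/funext => s.
by rewrite -(big_enum_val (A := J) (fun j => a j * x j s)); apply: eq_bigl.
Qed.

End Sets.

Lemma mxmul_cost_leq a b c N N' M M' : (N <= N')%N -> (M' <= M)%N ->
  mxmul_cost a b c N' M' -> mxmul_cost a b c N M.
Proof.
move=> leN leM mulM S A B szA szB; apply: computable_sub (mulM S A B _ _) => //.
  by move=> s i j; exact: leq_trans leN.
by move=> s i j; exact: leq_trans leN.
Qed.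

Definition mxpairs (a b : nat) := [seq (i, j) | i <- enum 'I_a, j <- enum 'I_b].

Lemma mem_mxpairs a b i j : (i, j) \in mxpairs a b.
Proof. by apply/allpairsP; exists (i, j); rewrite !mem_enum. Qed.

Lemma entriesE (a b : nat) (X : 'M[K]_(a, b)) :
  entries X = [seq X ij.1 ij.2 | ij <- mxpairs a b].
Proof. by rewrite /mxpairs map_allpairs. Qed.

Lemma size_entries (a b : nat) (X : 'M[K]_(a, b)) : size (entries X) = size (mxpairs a b).
Proof. by rewrite entriesE size_map. Qed.

(** Entries with at most one coefficient are scalars, so the program can be run on the constant
    coefficients. *)
Lemma mxmul_cost_slp a b c (P : slp K) : computes_mulmx a b c P -> mxmul_cost a b c 1 (cost P).
Proof.
move=> hP S A B szA szB.
pose A0 s := \matrix_(i, j) (A s i j)`_0; pose B0 s := \matrix_(i, j) (B s i j)`_0.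
have sub (a' b' : nat) (X : S -> 'M[{poly K}]_(a', b')) :
    regs (fun s => entries (\matrix_(i, j) (X s i j)`_0)) `<=` mxset X `|` csts.
  move=> _ [i _ <-]; case: (ltnP i (size (mxpairs a' b'))) => hi; last first.
    by right; exists 0 => //; apply/funext => s; rewrite nth_default // size_entries.
  case E: (mxpairs a' b') => [|ij0 l]; first by rewrite E in hi.
  left; set ij := nth ij0 (mxpairs a' b') i.
  have -> : (fun s => (entries (\matrix_(i, j) (X s i j)`_0))`_i) =
            (fun s => (X s ij.1 ij.2)`_0); last exact: mxset_coef.
  by apply/funext => s; rewrite entriesE (nth_map ij0) // mxE.
rewrite -[cost P]addn0; apply: (computable_trans (T1 := regs (fun s => entries (A0 s *m B0 s)))).
  apply: computable_sub (computable_run (N := size (mxpairs a b) + size (mxpairs b c))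
    (out := fun s => entries (A0 s *m B0 s)) _ (fun s => hP (A0 s) (B0 s)))
    => // [_ [i _ <-]|s]; last by rewrite size_cat !size_entries.
  case: (ltnP i (size (mxpairs a b))) => hi.
    have [|Ax|[x _ xE]] := sub _ _ A (fun s => (entries (A0 s))`_i); first by exists i.
    + by left; left; congr (mxset A _): Ax; apply/funext => s; rewrite nth_cat size_entries hi.
    by right; exists x => //; rewrite xE; apply/funext => s; rewrite nth_cat size_entries hi.
  have [|Bx|[x _ xE]] := sub _ _ B (fun s => (entries (B0 s))`_(i - size (mxpairs a b))%N).
  + by exists (i - size (mxpairs a b))%N.
  + by left; right; congr (mxset B _): Bx; apply/funext => s; rewrite nth_cat size_entries ltnNge hi.
  by right; exists x => //; rewrite xE; apply/funext => s; rewrite nth_cat size_entries ltnNge hi.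
apply: computable0 => _ [i _ [j _ [l _ <-]]].
have ABE s : (A s *m B s) i j = ((A0 s *m B0 s) i j)%:P.
  rewrite !mxE rmorph_sum; apply: eq_bigr => z _; rewrite !mxE rmorphM /=.
  by rewrite -!size1_polyC.
case: l => [|l]; last first.
  by right; exists 0 => //; apply/funext => s; rewrite ABE coefC.
left; right; exists (index (i, j) (mxpairs a c)) => //; apply/funext => s.
have ijin := mem_mxpairs i j.
by rewrite ABE coefC eqxx entriesE (nth_map (i, j)) ?index_mem // nth_index.
Qed.

End Mxmul.

Section Toom.
Variables (K : fieldType) (k : nat) (I : finType) (u v w : I -> nat -> K).
Hypothesis uvw : forall i j l, (i < k)%N -> (j < k)%N -> (l < 2 * k)%N ->
  \sum_rho u rho i * v rho j * w rho l = (i + j == l)%N%:R.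

(** The evaluation step of Toom's method. *)
Definition lincomb (z : nat -> K) N (p : {poly K}) := \sum_(i < k) z i *: blk N i p.

(** In [X^N], both factors are polynomials with [k] coefficients, namely their blocks. The
    decomposition over [K] stays valid for coefficients in a commutative [K]-algebra. *)
Lemma mul_decomp N (p q : {poly K}) : (0 < N)%N ->
  (size p <= k * N)%N -> (size q <= k * N)%N ->
  p * q = \sum_(l < 2 * k) \sum_rho
    w rho l *: (lincomb (u rho) N p * lincomb (v rho) N q) * 'X^(l * N).
Proof.
move=> N0 szp szq; rewrite {1}(sum_blk N0 szp) {1}(sum_blk N0 szq).
transitivity (\sum_(l < 2 * k) \sum_(i < k) \sum_(j < k)
   (i + j == l)%N%:R *: (blk N i p * blk N j q * 'X^(l * N))).
  rewrite big_distrlr /= [RHS]exchange_big /=; apply: eq_bigr => i _.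
  rewrite [RHS]exchange_big /=; apply: eq_bigr => j _.
  have ij : (i + j < 2 * k)%N by have := ltn_ord i; have := ltn_ord j; lia.
  rewrite (bigD1 (Ordinal ij)) //= eqxx scale1r big1 ?addr0 => [|l lij].
    by rewrite mulnDl exprD mulrACA.
  by rewrite -val_eqE eq_sym in lij; rewrite (negPf lij) scale0r.
apply: eq_bigr => l _.
under eq_bigr => i _ do under eq_bigr => j _ do
  rewrite -(uvw (ltn_ord i) (ltn_ord j) (ltn_ord l)) scaler_suml.
rewrite exchange_big /=.
under eq_bigr => j _ do rewrite exchange_big /=.
rewrite exchange_big /=; apply: eq_bigr => r _.
rewrite /lincomb big_distrlr /= scaler_sumr mulr_suml exchange_big /=; apply: eq_bigr => i _ /=.
rewrite scaler_sumr mulr_suml; apply: eq_bigr => j _.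
rewrite -!scalerAl -scalerAr -!scalerAl !scalerA; congr (_ *: _); ring.
Qed.

(** Evaluation acts linearly on every entry, so the identity for polynomials, summed over the inner
    index, becomes one for matrices: [#|I|] products with short entries. The second summand pays for
    evaluations and recombination. *)
Lemma mxmul_cost_toom a b c N M : (0 < N)%N -> mxmul_cost K a b c N M ->
  mxmul_cost K a b c (k * N)
    (#|I| * M + 8 * #|I| * k ^ 2 * (a * b + b * c + a * c) * N).
Proof.
move=> N0 mulM S A B szA szB.
pose U r s := map_mx (lincomb (u r) N) (A s); pose V r s := map_mx (lincomb (v r) N) (B s).
have sz_lin z p : (size (lincomb z N p) <= N)%N.
  apply: leq_trans (size_sum _ _ _) _; apply/bigmax_leqP => i _.
  exact: leq_trans (size_scale_leq _ _) (size_blk _ _ _).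
have comp_lin (a' b' : nat) (X : S -> 'M[{poly K}]_(a', b')) z :
    computable (mxset X) (a' * b' * N * (2 * k)) (mxset (fun s => map_mx (lincomb z N) (X s))).
  apply: computable_mxset => [s i j|i j l lN]; first by rewrite mxE.
  pose x (i0 : 'I_k) s := (X s i j)`_(i0 * N + l)%N.
  have := @computable_sum K S k (mxset X) z x; rewrite /x => h.
  have {}h := h (fun i0 => or_introl (mxset_coef _ _ _ _)).
  apply: computable_sub h => // _ ->; apply/funext => s.
  rewrite mxE coef_sum; apply: eq_bigr => i0 _.
  by rewrite coefZ coef_poly lN.
pose P r s := U r s *m V r s.
have compP r : computable (mxset A `|` mxset B)
    (a * b * N * (2 * k) + (b * c * N * (2 * k) + M)) (mxset (P r)).
  apply: computable_trans.
    by apply: computable_subl (comp_lin _ _ A (u r)) => x; left; left.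
  apply: computable_trans.
    by apply: computable_subl (comp_lin _ _ B (v r)) => x; left; left; right.
  apply: computable_sub (mulM S (U r) (V r) _ _) => // [x [h|h]|s i j|s i j].
  - by left; left; right.
  - by left; right.
  - by rewrite /U mxE.
  - by rewrite /V mxE.
have szAB s i j : (size ((A s *m B s) i j) <= 2 * k * N)%N.
  rewrite mxE; apply: leq_trans (size_sum _ _ _) _; apply/bigmax_leqP => z _.
  apply: leq_trans (size_polyMleq _ _) _.
  by apply: leq_trans (leq_pred _) _; rewrite -mulnA mul2n -addnn leq_add.
have mulE s i j : (A s *m B s) i j = \sum_(l < 2 * k) \sum_r
    w r l *: P r s i j * 'X^(l * N).
  rewrite mxE; under eq_bigr => z _ do rewrite (mul_decomp N0 (szA s i z) (szB s z j)).
  rewrite exchange_big; apply: eq_bigr => l _ /=.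
  rewrite exchange_big; apply: eq_bigr => r _ /=.
  rewrite mxE scaler_sumr mulr_suml; apply: eq_bigr => z _.
  by rewrite !mxE.
have compAB i j l : computable (\bigcup_r mxset (P r)) (2 * #|{: 'I_(2 * k) * I}|)
    [set fun s => ((A s *m B s) i j)`_l].
  (* Multiplication by [X^(t.1 * N)] only moves coefficients; the test yields zero below the shift,
     where the natural subtraction would be truncated. *)
  pose x (t : 'I_(2 * k) * I) s := if (l < t.1 * N)%N then 0 else (P t.2 s i j)`_(l - t.1 * N)%N.
  have Px t : ((\bigcup_r mxset (P r)) `|` csts) (x t).
    rewrite /x; case: (ltnP l (t.1 * N)) => _; first by right; exists 0.
    by left; exists t.2 => //; exact: mxset_coef.
  apply: computable_sub (computable_sum_fin (fun t : 'I_(2 * k) * I => w t.2 t.1) Px) => // _ ->.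
  apply/funext => s; rewrite mulE coef_sum.
  rewrite -(pair_bigA _ (fun (t1 : 'I_(2 * k)) (t2 : I) => w t2 t1 * x (t1, t2) s)) /=.
  apply: eq_bigr => t1 _; rewrite coef_sum; apply: eq_bigr => t2 _.
  by rewrite -scalerAl coefZ coefMXn.
have := computable_trans (computable_bigcup compP)
   (computable_subl _ (computable_mxset szAB (fun i j l _ => compAB i j l))).
move=> /(_ (fun x Px => or_introl (or_intror Px))); apply: computable_sub => //.
rewrite card_prod card_ord; set r := #|I|; pose X := (r * N * (a * b + b * c))%N.
have lekk : (k * X <= k * k * X)%N.
  by rewrite leq_mul2r; case: (k) => [|k']; rewrite ?orbT // leq_pmulr ?orbT.
have -> : (r * (a * b * N * (2 * k) + (b * c * N * (2 * k) + M)) +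
   a * c * (2 * k * N) * (2 * (2 * k * r)) =
   r * M + 2 * (k * X) + 8 * (k * k * (r * N * (a * c))))%N by rewrite /X; ring.
have -> : (r * M + 8 * r * k ^ 2 * (a * b + b * c + a * c) * N =
  r * M + 8 * (k * k * X) + 8 * (k * k * (r * N * (a * c))))%N.
  by rewrite /X -mulnn; ring.
by rewrite leq_add2r leq_add2l leq_mul.
Qed.

End Toom.

Lemma mxmul_cost_expn (K : fieldType) (k : nat) (I : finType) (a b c M : nat) :
  polymul_decomp K k I -> (k < #|I|)%N -> (0 < k)%N -> mxmul_cost K a b c 1 M ->
  forall j, mxmul_cost K a b c (k ^ j)
    ((M + 8 * #|I| * k ^ 2 * (a * b + b * c + a * c)) * #|I| ^ j).
Proof.
case=> u [v [w uvw]] kI k0 mul1 j.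
set D := (8 * #|I| * k ^ 2 * (a * b + b * c + a * c))%N.
(* The summand [D * k ^ j] strengthens the induction: a level adds [D * k ^ j] operations, and the
   [k.+1] copies of this term then present are at most [#|I|] copies. *)
suff [M' mulM' leM'] : exists2 M', mxmul_cost K a b c (k ^ j) M' &
    (M' + D * k ^ j <= (M + D) * #|I| ^ j)%N.
  by apply: mxmul_cost_leq mulM' => //; exact: leq_trans (leq_addr _ _) leM'.
elim: j => [|j [M' mulM' leM']]; first by exists M => //; rewrite !muln1.
exists (#|I| * M' + D * k ^ j)%N.
  by rewrite expnS; apply: (mxmul_cost_toom uvw) => //; rewrite expn_gt0 k0.
rewrite !expnS; set r := #|I| in D leM' kI *; set kj := (k ^ j)%N in leM' *.
have h1 : (r * (M' + D * kj) <= r * ((M + D) * r ^ j))%N by rewrite leq_mul2l leM' orbT.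
have h2 : (k.+1 * (D * kj) <= r * (D * kj))%N by rewrite leq_mul2r kI orbT.
move: h1 h2; rewrite mulnDr mulSn; set e := (r ^ j)%N => h1 h2.
have -> : ((M + D) * (r * e) = r * ((M + D) * e))%N by ring.
have -> : (D * (k * kj) = k * (D * kj))%N by ring.
lia.
Qed.

(** * Division with remainder *)

Section Reversal.
Variable K : fieldType.
Implicit Types p q : {poly K}.

(** This is [X^d p(1/X)] if [p] has degree at most [d]; coefficients of higher degree are
    dropped. *)
Definition rev_poly (d : nat) p : {poly K} := \poly_(i < d.+1) p`_(d - i)%N.

Lemma coef_rev_poly d p i : (rev_poly d p)`_i = if (i <= d)%N then p`_(d - i)%N else 0.
Proof. by rewrite coef_poly ltnS. Qed.

Lemma rev_polyB d p q : rev_poly d (p - q) = rev_poly d p - rev_poly d q.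
Proof.
by apply/polyP => i; rewrite !(coef_rev_poly, coefB); case: leqP; rewrite ?subrr.
Qed.

Lemma rev_polyM a b p q : (size p <= a.+1)%N -> (size q <= b.+1)%N ->
  rev_poly (a + b) (p * q) = rev_poly a p * rev_poly b q.
Proof.
have sumE d (r : {poly K}) : (size r <= d.+1)%N -> r = \sum_(i < d.+1) r`_i *: 'X^i.
  move=> szr; rewrite -poly_def; apply/polyP => i; rewrite coef_poly.
  by case: ltnP => // le; rewrite nth_default // (leq_trans szr).
have revE d (r : {poly K}) : rev_poly d r = \sum_(i < d.+1) r`_i *: 'X^(d - i).
  rewrite /rev_poly poly_def (reindex_inj rev_ord_inj) /=; apply: eq_bigr => i _.
  by rewrite !subSS subKn // -ltnS.
move=> szp szq; rewrite (revE a) (revE b) {1}(sumE _ _ szp) {1}(sumE _ _ szq).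
rewrite !big_distrlr /=.
apply/polyP => l; rewrite coef_rev_poly !coef_sum.
have coefE (i : 'I_a.+1) (j : 'I_b.+1) :
  (p`_i *: 'X^(a - i) * (q`_j *: 'X^(b - j)))`_l =
  if (l <= a + b)%N then (p`_i *: 'X^i * (q`_j *: 'X^j))`_(a + b - l)%N else 0.
  rewrite -!scalerAl -!scalerAr !coefZ -!exprD !coefXn.
  have := ltn_ord i; have := ltn_ord j; rewrite !ltnS => jb ia.
  case: leqP => lab; last by rewrite (_ : (l == _) = false) ?mulr0 //; lia.
  by rewrite (_ : (l == _) = (a + b - l == i + j)%N) //; lia.
case: (leqP l (a + b)) coefE => lab coefE.
  apply: eq_bigr => i _; rewrite !coef_sum; apply: eq_bigr => j _; exact/esym/coefE.
by rewrite big1 // => i _; rewrite coef_sum big1 // => j _; exact: coefE.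
Qed.

End Reversal.

(** * Newton's iteration for inverse power series *)

Section Newton.
Variables (K : fieldType) (L : nat) (F : {poly K}).

(** Every round works at the full length [L] rather than at doubling lengths; the resulting
    logarithmic factor is absorbed by the exponent [1 + eps]. *)
Fixpoint newton (i : nat) : {poly K} :=
  if i is i'.+1 then take_poly L (newton i' * (2%:P - take_poly L (F * newton i')))
  else (F`_0)^-1%:P.

Lemma size_newton i : (0 < L)%N -> (size (newton i) <= L)%N.
Proof.
case: i => [|i] L0 /=; last exact: size_take_poly.
exact: leq_trans (size_polyC_leq1 _) _.
Qed.

Lemma dvd_take_poly (p : {poly K}) : 'X^L %| p - take_poly L p.
Proof. by rewrite -{1}(poly_take_drop L p) addrAC subrr add0r dvdp_mull. Qed.

(** A round squares the error [1 - F G], up to multiples of [X^L] that come from the truncations. *)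
Lemma newtonP i : F`_0 != 0 -> 'X^(minn (2 ^ i) L) %| 1 - F * newton i.
Proof.
move=> F0; elim: i => [|i IH].
  apply: (@dvdp_trans _ 'X^1); first by rewrite dvdp_exp2l // geq_minl.
  rewrite expr1 -[X in X %| _]subr0 -polyC0 dvdp_XsubCl rootE.
  by rewrite !hornerE horner_coef0 mulfV // subrr.
set G := newton i in IH *; set m := minn _ _.
have mL : (m <= L)%N := geq_minr _ _.
have XL (p : {poly K}) : 'X^m %| p - take_poly L p.
  by apply: (dvdp_trans _ (dvd_take_poly p)); rewrite dvdp_exp2l.
have := XL (F * G); set T := take_poly L (F * G) => XT.
have -> : 1 - F * newton i.+1 = (1 - F * G) ^+ 2 - F * G * (F * G - T)
  + F * (G * (2%:P - T) - newton i.+1).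
  by rewrite (_ : 2%:P = 1 + 1 :> {poly K}) ?polyCD //; ring.
have XG : 'X^m %| F * (G * (2%:P - T) - newton i.+1) by apply: dvdp_mull; exact: XL.
apply: dvdp_add => //; apply: dvdp_sub; last exact: dvdp_mull.
apply: (dvdp_trans _ (dvdp_exp2r 2 IH)); rewrite -exprM dvdp_exp2l // /m expnS; lia.
Qed.
End Newton.

(* [X^(N - size f) * f] has size exactly [N], whatever the degree of [f], and
   its top coefficients are inverted by [G] modulo [X^(2N + 1)]. *)
Lemma modp_rev (K : fieldType) (N : nat) (f G h : {poly K}) :
  let F : {poly K} := 'X^(N - size f) * f in
  let H : {poly K} := 'X^(N - size f) * h in
  let Q := rev_poly (2 * N) (rev_poly (3 * N).-1 H * G) in
  (0 < N)%N -> f != 0 -> (size f <= N)%N -> (size h <= 2 * N)%N ->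
  'X^((2 * N).+1) %| 1 - rev_poly N.-1 F * G ->
  (H - Q * F) * 'X^(size f) = h %% f * 'X^N.
Proof.
move=> F H Q N0 f0 szf szh dvdG.
have szXM n (p : {poly K}) : p != 0 -> size ('X^n * p) = (n + size p)%N.
  by move=> p0; rewrite mulrC size_mulXn.
have szF : size F = N by rewrite szXM // subnK.
have F0 : F != 0 by rewrite -size_poly_gt0 szF.
have szH : (size H <= 3 * N)%N.
  have [h0|h0] := eqVneq h 0; first by rewrite /H h0 mulr0 size_poly0.
  rewrite szXM //; lia.
have szQ : (size Q <= (2 * N).+1)%N by exact: size_poly.
have eN : (2 * N + N.-1 = (3 * N).-1)%N by lia.
have szR : (size (H - Q * F)%R <= 3 * N)%N.
  rewrite (leq_trans (size_polyD _ _)) // geq_max szH size_polyN.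
  by rewrite (leq_trans (size_polyMleq _ _)) // szF; move: (size Q) szQ => sQ; lia.
have dvdR : 'X^((2 * N).+1) %| rev_poly (3 * N).-1 (H - Q * F).
  rewrite rev_polyB -[X in rev_poly X (Q * F)]eN rev_polyM ?szF ?prednK //.
  set RH := rev_poly _ H; set RF := rev_poly _ F.
  have -> : rev_poly (2 * N) Q = take_poly (2 * N).+1 (RH * G).
    apply/polyP => i; rewrite coef_rev_poly /Q coef_rev_poly leq_subr coef_take_poly ltnS.
    by case: leqP => // le; rewrite subKn.
  have -> : RH - take_poly (2 * N).+1 (RH * G) * RF =
      RH * (1 - RF * G) + (RH * G - take_poly (2 * N).+1 (RH * G)) * RF by ring.
  by apply: dvdp_add; [exact: dvdp_mull|apply: dvdp_mulr; exact: dvd_take_poly].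
(* Among the [3N] coefficients of [H - Q F], the top [2N + 1] vanish, so at most [N - 1] remain. *)
have szR' : (size (H - Q * F)%R < size F)%N.
  rewrite szF -[X in (_ < X)%N](prednK N0) ltnS; apply/leq_sizeP => j leNj.
  have [ltj|] := ltnP j (3 * N); last by move=> le; rewrite nth_default // (leq_trans szR).
  have [D RD] := dvdpP _ _ dvdR.
  have := congr1 (fun p : {poly K} => p`_((3 * N).-1 - j)%N) RD.
  rewrite coef_rev_poly leq_subr coefMXn ltnS (_ : (_ <= 2 * N)%N); last by lia.
  by rewrite subKn //; lia.
have RE : H - Q * F = H %% F by apply: (@modpP _ H Q) => //; ring.
have -> : H - Q * F = 'X^(N - size f) * (h %% f).
  rewrite RE; apply/esym; apply: (@modpP _ _ (h %/ f)).
    by rewrite /H {1}(divp_eq h f) /F; ring.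
  have [->|r0] := eqVneq (h %% f) 0; first by rewrite mulr0 size_poly0 szF.
  have : (size (h %% f)%R < size f)%N by rewrite ltn_modp.
  by rewrite szXM // szF; move: (size (h %% f)) => r; lia.
(* The factor [X^(size f)] completes the shift, which varies with [f], to the fixed [X^N]. *)
by rewrite mulrAC -exprD subnK // mulrC.
Qed.

(** * Circuits for polynomial arithmetic *)

Definition pmul_cost (K : fieldType) (L M : nat) : Prop :=
  forall (S : Type) (p q : S -> {poly K}),
    (forall s, (size (p s) <= L)%N) -> (forall s, (size (q s) <= L)%N) ->
    computable (polyset p `|` polyset q) M (polyset (fun s => p s * q s)).

Lemma pmul_cost_mx (K : fieldType) L M : mxmul_cost K 1 1 1 L M -> pmul_cost K L M.
Proof.
move=> mulM S p q szp szq.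
pose A s : 'M_1 := \matrix_(i, j) p s; pose B s : 'M_1 := \matrix_(i, j) q s.
have szA s i j : (size (A s i j) <= L)%N by rewrite mxE.
have szB s i j : (size (B s i j) <= L)%N by rewrite mxE.
apply: computable_sub (mulM S A B szA szB) => //.
  move=> x [] [i _ [j _ [l _ <-]]]; left; [left|right]; exists l => //;
    by apply/funext => s; rewrite mxE.
move=> x [l _ <-]; exists 0 => //; exists 0 => //; exists l => //.
by apply/funext => s; rewrite !mxE big_ord1 !mxE.
Qed.

Ltac inset := first [assumption | left; inset | right; inset].
Ltac subset := let x := fresh "x" in let h := fresh "mem_x" in intros x h;
  first [inset | match goal with sub : _ `<=` _ |- _ => destruct (sub _ h); inset end].

Section Arith.
Variables (K : fieldType) (S : Type).
Implicit Types (B T : set (S -> K)) (p q : S -> {poly K}).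

Lemma polyset_free B p :
  (forall i, (B `|` csts) (fun s => (p s)`_i)) -> polyset p `<=` B `|` csts.
Proof. by move=> h _ [i _ <-]. Qed.

Lemma computable_free B p :
  (forall i, (B `|` csts) (fun s => (p s)`_i)) -> computable B 0 (polyset p).
Proof. by move=> h; apply/computable0/polyset_free. Qed.

Lemma polyset_coefE B p : polyset p `<=` B `|` csts -> forall i, (B `|` csts) (fun s => (p s)`_i).
Proof. by move=> + i; apply; exact: polyset_coef. Qed.

Lemma polysetC (a : K) B : polyset (fun _ => a%:P) `<=` B `|` csts.
Proof. by move=> _ [i _ <-]; right; eexists. Qed.

Lemma computable_polyD B N p q : polyset p `<=` B `|` csts -> polyset q `<=` B `|` csts ->
  (forall s, (size (p s + q s)%R <= N)%N) -> computable B N (polyset (fun s => p s + q s)).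
Proof.
move=> sp sq szpq; rewrite -[N]muln1; apply: computable_polyset => // i _.
have -> : (fun s => (p s + q s)`_i) = (fun s => (p s)`_i + (q s)`_i).
  by apply/funext => s; rewrite coefD.
by apply: computable1; apply: StepAdd; exact: polyset_coefE.
Qed.

Lemma computable_polyB B N p q : polyset p `<=` B `|` csts -> polyset q `<=` B `|` csts ->
  (forall s, (size (p s - q s)%R <= N)%N) -> computable B N (polyset (fun s => p s - q s)).
Proof.
move=> sp sq szpq; rewrite -[N]muln1; apply: computable_polyset => // i _.
have -> : (fun s => (p s - q s)`_i) = (fun s => (p s)`_i - (q s)`_i).
  by apply/funext => s; rewrite coefB.
by apply: computable1; apply: StepSub; exact: polyset_coefE.
Qed.

Lemma computable_polyM B L M p q : pmul_cost K L M ->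
  polyset p `<=` B `|` csts -> polyset q `<=` B `|` csts ->
  (forall s, (size (p s) <= L)%N) -> (forall s, (size (q s) <= L)%N) ->
  computable B M (polyset (fun s => p s * q s)).
Proof.
move=> mulM sp sq szp szq; apply: computable_subl (mulM S p q szp szq).
by move=> x [/sp|/sq].
Qed.

(** Selecting coefficients or moving them to known places costs nothing; truncation, reversal and
    cutting into blocks are of this kind. *)
Lemma polyset_poly B N (E : S -> nat -> K) :
  (forall i, (i < N)%N -> (B `|` csts) (fun s => E s i)) ->
  polyset (fun s => \poly_(i < N) E s i) `<=` B `|` csts.
Proof.
move=> h; apply: polyset_free => i; case: (ltnP i N) => iN.
  rewrite (_ : (fun s => _) = (fun s => E s i)); first exact: h.
  by apply/funext => s; rewrite coef_poly iN.
by right; exists 0 => //; apply/funext => s; rewrite coef_poly ltnNge iN.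
Qed.

Lemma polyset_take B N p : polyset p `<=` B `|` csts ->
  polyset (fun s => take_poly N (p s)) `<=` B `|` csts.
Proof. by move=> sp; apply: polyset_poly => i _; exact: polyset_coefE. Qed.

Lemma polyset_rev B N p : polyset p `<=` B `|` csts ->
  polyset (fun s => rev_poly N (p s)) `<=` B `|` csts.
Proof. by move=> sp; apply: polyset_poly => i _; exact: polyset_coefE. Qed.

(** One division starts the iteration; every round takes two products and one subtraction. *)
Lemma computable_newton B L M (F : S -> {poly K}) i : (0 < L)%N -> pmul_cost K L M ->
  polyset F `<=` B `|` csts -> (forall s, (size (F s) <= L)%N) -> (forall s, (F s)`_0 != 0) ->
  computable B (1 + i * (2 * M + L)) (polyset (fun s => newton L (F s) i)).
Proof.
move=> L0 mulM sF szF F0; have sznewt s := size_newton (F s) _ L0.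
elim: i => [|i IH].
  rewrite -[(1 + _)%N]addn0.
  apply: (computable_trans (T1 := [set fun s => 1 / (F s)`_0])).
    by apply: computable1; apply: (@StepDiv _ _ _ (fun _ => 1)) => //;
       [right; exists 1|exact: polyset_coefE].
  apply: computable_free => -[|j]; last first.
    by right; exists 0 => //; apply/funext => s; rewrite coefC.
  by left; right; apply/funext => s; rewrite coefC eqxx div1r.
rewrite mulSn addnCA addnC; apply: (computable_trans IH).
rewrite mul2n -addnn -addnA.
apply: computable_trans.
  by apply: (computable_polyM mulM (p := F) (q := fun s => newton L (F s) i)) => //; subset.
rewrite addnC; apply: computable_trans.
  apply: (@computable_polyB _ L (fun _ => 2%:P) (fun s => take_poly L (F s * newton L (F s) i))).
  - exact: polysetC.
  - by apply: polyset_take; subset.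
  - move=> s; rewrite (leq_trans (size_polyD _ _)) // geq_max size_polyN size_take_poly.
    by rewrite (leq_trans (size_polyC_leq1 _)).
rewrite -[M]addn0; apply: computable_trans.
  apply: (computable_polyM mulM (p := fun s => newton L (F s) i)
    (q := fun s => 2%:P - take_poly L (F s * newton L (F s) i))) => //; try by subset.
  move=> s; rewrite (leq_trans (size_polyD _ _)) // geq_max size_polyN size_take_poly.
  by rewrite (leq_trans (size_polyC_leq1 _)).
by apply: computable0; apply: polyset_take; subset.
Qed.

End Arith.

(** * Circuits for remainders *)

Section Remainder.
Variables (K : fieldType) (S : Type) (N : nat) (f : S -> {poly K}).
Hypotheses (N0 : (0 < N)%N) (f0 : forall s, f s != 0) (szf : forall s, (size (f s) <= N)%N).

Let Xsz s : {poly K} := 'X^(size (f s)).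
Let Xsh s : {poly K} := 'X^(N - size (f s)).
Let F s : {poly K} := Xsh s * f s.

(** The degree of [f] depends on the input, and circuits have no jumps. Encoded in the coefficients
    of [X^(size f)], it can be used through multiplication. *)
Lemma computable_Xsize : computable (polyset f) (2 * N + 1) (polyset Xsz).
Proof.
(* Scanning from the top, [z i] vanishes iff all coefficients from [i] on do. *)
pose z i s : K := if (size (f s) <= i)%N then 0 else 1.
have zbig i : (N <= i)%N -> csts (z i).
  move=> Ni; exists 0 => //; apply/funext => s.
  by rewrite /z (leq_trans (szf s)).
have compz d : (d <= N)%N -> computable (polyset f) d [set v | exists2 i, (N - d <= i)%N & v = z i].
  elim: d => [|d IH] dN.
    by apply: computable0 => _ [i iN ->]; right; apply: zbig; rewrite -[N]subn0.
  rewrite -addn1; apply: computable_trans (IH (ltnW dN)) _.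
  set T := (X in _ `|` X).
  have Tz i : (N - d <= i)%N -> T (z i) by exists i.
  set i0 := (N - d.+1)%N; have Ei : (N - d = i0.+1)%N by rewrite /i0; lia.
  (* If the coefficient at [i0] is zero, the size cannot be [i0.+1], since the leading coefficient
     is nonzero; so [z i0] and [z i0.+1] agree. *)
  have zE : z i0 = (fun s => if (f s)`_i0 == 0 then z i0.+1 s else 1).
    apply/funext => s; rewrite /z.
    case: eqP => [c0|/eqP c0]; last first.
      by case: leqP => // le; rewrite nth_default ?eqxx in c0.
    congr (if _ then _ else _); apply/idP/idP => [|le]; first exact: leqW.
    rewrite leqNgt; apply/negP => lt.
    have eqs : size (f s) = i0.+1 by apply/eqP; rewrite eqn_leq le.
    by have := f0 s; rewrite -lead_coef_eq0 /lead_coef eqs /= c0 eqxx.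
  have : computable (polyset f `|` T) 1 [set z i0].
    rewrite zE; apply: computable1; apply: StepIf; [left; left; exact: polyset_coef| |right; exists 1 => //].
    by left; right; apply: Tz; rewrite Ei.
  move/computable_keep; apply: computable_sub => //.
  move=> _ [i iN ->]; have [->|ne] := eqVneq i i0; first by right.
  rewrite addn1 in iN; left; right; apply: Tz.
  by rewrite Ei ltn_neqAle eq_sym ne.
have -> : (2 * N + 1 = N + N.+1 * 1)%N by lia.
apply: computable_trans (compz N (leqnn _)) _.
apply: computable_polyset => [s|i _]; first by rewrite size_polyXn ltnS.
have zin j : (polyset f `|` [set v | exists2 i, (N - N <= i)%N & v = z i] `|` csts) (z j).
  by left; right; exists j; rewrite ?subnn.
case: i => [|i].
  apply: ComputableDone => _ ->; right; exists 0 => //; apply/funext => s; rewrite coefXn eq_sym size_poly_eq0.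
  by rewrite (negPf (f0 s)).
(* The size is [i.+1] exactly if it exceeds [i] but not [i.+1]. *)
have -> : (fun s => (Xsz s)`_i.+1) = (fun s => z i s - z i.+1 s).
  apply/funext => s; rewrite coefXn /z -[(_ <= i)%N]ltnS eq_sym.
  by case: ltngtP => _; rewrite ?subrr ?subr0.
by apply: computable1; apply: StepSub.
Qed.

(** Up to degree [N], the two powers of [X] have the same coefficients in opposite order. *)
Lemma polyset_Xshift B : polyset Xsz `<=` B `|` csts -> polyset Xsh `<=` B `|` csts.
Proof.
move=> sX; apply: polyset_free => i; case: (leqP i N) => iN.
  rewrite (_ : (fun s => _) = (fun s => (Xsz s)`_(N - i)%N)); first exact: polyset_coefE.
  apply/funext => s; rewrite !coefXn; congr (_%:R); have := szf s; lia.
right; exists 0 => //; apply/funext => s; rewrite coefXn (_ : (i == _) = false) //; lia.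
Qed.

Variables (L M : nat).
Hypotheses (mulM : pmul_cost K L M) (NL : (3 * N <= L)%N).

Let size_Xsz s : (size (Xsz s) <= N.+1)%N.
Proof. by rewrite size_polyXn ltnS. Qed.

Let size_Xsh s : (size (Xsh s) <= N)%N.
Proof.
rewrite size_polyXn; have := szf s; have := f0 s; rewrite -size_poly_gt0.
by move: (size _) => n; lia.
Qed.

Let size_F s : size (F s) = N.
Proof. by rewrite /F mulrC size_mulXn // subnK. Qed.

Let G e s := newton L (rev_poly N.-1 (F s)) e.

(** What depends on [f] alone is computed once and shared by all reductions modulo [f]. *)
Definition rem_data e : set (S -> K) :=
  polyset Xsz `|` polyset F `|` polyset (G e).

Lemma computable_rem_data e :
  computable (polyset f) (2 * N + 1 + M + (1 + e * (2 * M + L))) (rem_data e).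
Proof.
rewrite -[(_ + M + _)%N]addnA; apply: computable_trans computable_Xsize _.
have sXsh : polyset Xsh `<=` (polyset f `|` polyset Xsz) `|` csts by apply: polyset_Xshift; subset.
apply: computable_trans.
  apply: (computable_polyM mulM (p := Xsh) (q := f)) => // [|s|s]; first by subset.
    by have := size_Xsh s; lia.
  by have := szf s; lia.
have cG : computable (polyset f `|` polyset Xsz `|` polyset F) (1 + e * (2 * M + L)) (polyset (G e)).
  apply: computable_newton => //; first by lia.
  - by apply: polyset_rev; subset.
  - by move=> s; rewrite (leq_trans (size_poly _ _)) // prednK //; lia.
  (* The constant coefficient of the reversal is the leading coefficient of [F], whose size is
     exactly [N]; so it is nonzero on every input. *)
  move=> s; rewrite coef_rev_poly subn0 /= -{1}(size_F s).
  rewrite -[(F s)`__]/(lead_coef (F s)) lead_coef_eq0 -size_poly_gt0 size_F.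
  done.
by apply: computable_sub (computable_keep cG) => // x [[h|h]|h]; inset.
Qed.

(** Four products, by [Xsh], the inverse [G e], [F] and [Xsz], and one subtraction. *)
Lemma computable_modp e (h : S -> {poly K}) : (L <= 2 ^ e)%N -> (forall s, (size (h s) <= 2 * N)%N) ->
  computable (rem_data e `|` polyset h) (4 * M + L) (polyset (fun s => h s %% f s)).
Proof.
move=> Le szh; set B := _ `|` _.
have sF : polyset F `<=` B `|` csts by rewrite /B /rem_data; subset.
have sG : polyset (G e) `<=` B `|` csts by rewrite /B /rem_data; subset.
have sX : polyset Xsz `<=` B `|` csts by rewrite /B /rem_data; subset.
have sh : polyset h `<=` B `|` csts by rewrite /B; subset.
have sXsh := polyset_Xshift sX.
pose H s := Xsh s * h s.
have szH s : (size (H s) <= L)%N.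
  have := size_Xsh s; have := szh s; have := size_polyMleq (Xsh s) (h s).
  by rewrite -/(H s); move: (size (H s)) (size (h s)) (size (Xsh s)) => a b c; lia.
have szG s : (size (G e s) <= L)%N by apply: size_newton; lia.
pose P s := rev_poly (3 * N).-1 (H s) * G e s.
pose Q s := rev_poly (2 * N) (P s).
have szrev d p : (d < L)%N -> (size (rev_poly d p : {poly K}) <= L)%N.
  by move=> dL; exact: leq_trans (size_poly _ _) dL.
have szQF s : (size (Q s * F s)%R <= L)%N.
  have := size_polyMleq (Q s) (F s); rewrite size_F.
  have : (size (Q s) <= (2 * N).+1)%N by exact: size_poly.
  by move: (size (Q s)) (size (Q s * F s)%R) => a b; lia.
have -> : (4 * M + L = M + (M + (M + (L + (M + 0)))))%N by lia.
apply: (computable_trans (T1 := polyset H)).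
  by apply: (computable_polyM mulM) => // s; [have := size_Xsh s|have := szh s]; lia.
apply: (computable_trans (T1 := polyset P)).
  apply: (computable_polyM mulM (p := fun s => rev_poly (3 * N).-1 (H s))) => //.
  - by apply: polyset_rev; subset.
  - by subset.
  - by move=> s; apply: szrev; lia.
apply: (computable_trans (T1 := polyset (fun s => Q s * F s))).
  apply: (computable_polyM mulM) => //.
  - by apply: polyset_rev; subset.
  - by subset.
  - by move=> s; apply: szrev; lia.
  - by move=> s; rewrite size_F; lia.
have szR s : (size (H s - Q s * F s)%R <= L)%N.
  by rewrite (leq_trans (size_polyD _ _)) // geq_max size_polyN szH szQF.
apply: (computable_trans (T1 := polyset (fun s => H s - Q s * F s))).
  by apply: computable_polyB => //; subset.
apply: (computable_trans (T1 := polyset (fun s => (H s - Q s * F s) * Xsz s))).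
  apply: (computable_polyM mulM (p := fun s => H s - Q s * F s)) => //; try by subset.
  by move=> s; have := size_Xsz s; lia.
(* By [modp_rev], the last product holds the remainder, shifted by [N] places. *)
apply: computable_free => i; left; right; exists (N + i)%N => //; apply/funext => s.
have dvdG : 'X^((2 * N).+1) %| 1 - rev_poly N.-1 (F s) * G e s.
  apply: (@dvdp_trans _ 'X^(minn (2 ^ e) L)).
    by rewrite dvdp_exp2l // (minn_idPr Le); lia.
  apply: newtonP; rewrite coef_rev_poly subn0 /= -{1}(size_F s).
  by rewrite -[(F s)`__]/(lead_coef (F s)) lead_coef_eq0 -size_poly_gt0 size_F.
have -> := modp_rev N0 (f0 s) (szf s) (szh s) dvdG.
by rewrite coefMXn ltnNge leq_addr /= addKn.
Qed.

End Remainder.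

(** * Modular composition *)

Section Composition.
Variables (K : fieldType) (n l : nat) (p : {poly {poly K}}) (g f : {poly K}).

(** The zeroth power 1 is left unreduced even for constant [f], so powers are compared modulo [f]
    only. *)
Fixpoint pow_mod k : {poly K} := if k is k'.+1 then (pow_mod k' * g) %% f else 1.

(** Entry [(i, t)] of the product of the matrix of coefficients of [p] by the matrix of blocks of
    the powers of [g]. *)
Definition comp_block i t : {poly K} :=
  \sum_(k < l) p`_(i * l + k)%N * blk n t (pow_mod k).

Definition comp_row i : {poly K} := \sum_(k < l) p`_(i * l + k)%N * pow_mod k.

Fixpoint comp_horner j : {poly K} :=
  if j is j'.+1 then (comp_horner j' * pow_mod l + comp_row (l - j)) %% f else 0.

Lemma modpM_congr a b c d : a %% f = b %% f -> c %% f = d %% f -> (a * c) %% f = (b * d) %% f.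
Proof.
by move=> ab cd; rewrite -modp_mul cd modp_mul mulrC -modp_mul ab modp_mul mulrC.
Qed.

Lemma pow_modE k : pow_mod k %% f = g ^+ k %% f.
Proof.
elim: k => // k IH; rewrite /= modp_id exprSr; exact: modpM_congr.
Qed.

Lemma comp_rowE i : comp_row i %% f = (blk l i p).[g] %% f.
Proof.
rewrite horner_poly /comp_row !(big_morph (fun a => a %% f) (modpD f) (mod0p f)).
by apply: eq_bigr => k _; apply: modpM_congr; rewrite // pow_modE.
Qed.

Lemma comp_hornerE : (0 < l)%N -> (size p <= l * l)%N -> comp_horner l = p.[g] %% f.
Proof.
move=> l0 szp.
(* Horner's rule runs from the top: after [j] steps the slices [l - j] to [l - 1] have been
   absorbed. *)
have h j : (0 < j)%N -> (j <= l)%N -> comp_horner j = 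
    (\sum_(i < j) (blk l (l - j + i)%N p).[g] * g ^+ (i * l)) %% f.
  elim: j => // -[_ _ l1|j IH _ jl].
    by rewrite /= mul0r add0r big_ord1 mulr1 addn0 comp_rowE.
  have -> : comp_horner j.+2 = (comp_horner j.+1 * pow_mod l + comp_row (l - j.+2)) %% f by [].
  rewrite modpD big_ord_recl modpD mulr1 addn0 comp_rowE [LHS]addrC; congr (_ + _).
  rewrite IH //; last exact: ltnW.
  rewrite mulrC modp_mul mulrC mulr_suml.
  rewrite !(big_morph (fun a => a %% f) (fun a b => modpD f a b) (mod0p f)).
  apply: eq_bigr => i _.
  rewrite lift0 mulSn exprD [g ^+ l * _]mulrC mulrA; apply: modpM_congr; last exact: pow_modE.

  by congr (((blk l _ p).[g] * _) %% f); lia.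
rewrite h // subnn {2}(sum_blk l0 szp) horner_sum; congr (_ %% _).
apply: eq_bigr => i _; rewrite add0n.
by rewrite hornerM hornerXn.
Qed.

Hypothesis n0 : (0 < n)%N.

(** The entries of the matrix product have up to [2n] coefficients, so neighbours overlap. Cutting
    each into a low and a high half gives two concatenations without overlap, joined by a single
    polynomial addition. *)
Lemma comp_row_blocks i T : (forall k, (size (pow_mod k) <= T * n)%N) ->
  (forall j, (size (p`_j)%R <= n)%N) ->
  comp_row i = \sum_(t < T) blk n 0 (comp_block i t) * 'X^(t * n) +
    (\sum_(t < T) blk n 1 (comp_block i t) * 'X^(t * n)) * 'X^n.
Proof.
move=> szpow szp; transitivity (\sum_(t < T) comp_block i t * 'X^(t * n)).
  under [RHS]eq_bigr => t _ do rewrite mulr_suml.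
  rewrite exchange_big; apply: eq_bigr => k _ /=.
  rewrite {1}(sum_blk n0 (szpow k)) mulr_sumr; apply: eq_bigr => t _.
  by rewrite mulrA.
rewrite mulr_suml -big_split; apply: eq_bigr => t _ /=.
have szc : (size (comp_block i t) <= 2 * n)%N.
  apply: leq_trans (size_sum _ _ _) _; apply/bigmax_leqP => k _.
  apply: leq_trans (size_polyMleq _ _) _; apply: leq_trans (leq_pred _) _.
  by rewrite mul2n -addnn leq_add // size_blk.
rewrite {1}(sum_blk n0 szc) big_ord_recl big_ord1 mul0n mul1n expr0 mulr1 mulrDl.
by rewrite mulrAC.
Qed.

Lemma size_comp_row i N : (n <= N)%N -> (forall k, (size (pow_mod k) <= N)%N) ->
  (forall j, (size (p`_j)%R <= n)%N) -> (size (comp_row i) <= 2 * N)%N.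
Proof.
move=> nN szpow szp; apply: leq_trans (size_sum _ _ _) _; apply/bigmax_leqP => k _.
apply: leq_trans (size_polyMleq _ _) _; apply: leq_trans (leq_pred _) _.
by rewrite mul2n -addnn leq_add // (leq_trans (szp _)).
Qed.

End Composition.

(** In the cost, the terms without [l] and [Mx] prepare the divisor, [Mx] is the matrix product, and
    the factor of [l] covers powers, rows and Horner steps. *)
Lemma computable_comp_rem (K : fieldType) (S : Type) (n m l L M e Mx : nat)
    (p : S -> {poly {poly K}}) (g f : S -> {poly K}) :
  (0 < n)%N -> (0 < m)%N -> (m <= l * l)%N -> (3 * (n * m) <= L)%N -> (L <= 2 ^ e)%N ->
  pmul_cost K L M -> mxmul_cost K l l (l * l) n Mx ->
  (forall s j, (size ((p s)`_j)%R <= n)%N) -> (forall s, (size (p s) <= m)%N) ->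
  (forall s, (size (g s) <= n * m)%N) -> (forall s, (size (f s) <= n * m)%N) ->
  (forall s, f s != 0) ->
  computable ((\bigcup_j polyset (fun s => (p s)`_j)) `|` polyset g `|` polyset f)
    (L + M + 1 + e * (2 * M + L) + l * (11 * M + 4 * L) + Mx)
    (polyset (fun s => (p s).[g s] %% f s)).
Proof.
move=> n0 m0 ml NL Le mulM mulMx szpj szp szg szf f0; set B := _ `|` _.
set N := (n * m)%N in NL szg szf.
have N0 : (0 < N)%N by rewrite muln_gt0 n0.
have NLL : (N <= L)%N by lia.
have l0 : (0 < l)%N by case: (l) ml => //; lia.
pose h k s := pow_mod (g s) (f s) k.
pose q i s := comp_row l (p s) (g s) (f s) i.
pose acc j s := comp_horner l (p s) (g s) (f s) j.
have szmod s a : (size (a %% f s)%R <= N)%N.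
  by apply: leq_trans (szf s); rewrite ltnW // ltn_modp.
have szh k s : (size (h k s) <= N)%N by case: k => [|k]; [rewrite size_poly1|exact: szmod].
have szacc j s : (size (acc j s) <= N)%N by case: j => [|j]; [rewrite size_poly0|exact: szmod].
have nN : (n <= N)%N by rewrite leq_pmulr.
have szq i s : (size (q i s) <= 2 * N)%N by apply: size_comp_row nN (szh^~ s) (szpj s).
have szM (a b : {poly K}) : (size a <= N)%N -> (size b <= N)%N -> (size (a * b)%R <= 2 * N)%N.
  move=> ha hb; apply: leq_trans (size_polyMleq _ _) _; apply: leq_trans (leq_pred _) _.
  by rewrite mul2n -addnn leq_add.
pose RD := rem_data N f L e.
have compmod B' (a : S -> {poly K}) : (forall s, (size (a s) <= 2 * N)%N) -> RD `<=` B' `|` csts ->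
    polyset a `<=` B' `|` csts -> computable B' (4 * M + L) (polyset (fun s => a s %% f s)).
  move=> sza sRD sa; apply: computable_subl (computable_modp N0 f0 szf mulM NL Le sza).
  by move=> x [/sRD|/sa].
have compRD : computable B (L + M + (1 + e * (2 * M + L))) RD.
  apply: computable_sub (computable_rem_data N0 f0 szf mulM NL e) => //; first by subset.
  by rewrite !leq_add2r; lia.
pose H := [set v | exists2 k, (k <= l)%N & polyset (h k) v].
have compH : computable (B `|` RD) (l * (5 * M + L)) H.
  rewrite /H; elim: (l) => [|j IH].
    apply: ComputableDone => v [k]; rewrite leqn0 => /eqP -> [i _ <-]; right.
    by exists ((1 : {poly K})`_i).
  rewrite mulSn addnC; apply: computable_trans IH _.
  set H' := [set v | _]; rewrite (_ : 5 * M + L = M + (4 * M + L))%N; last by lia.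
  have sh : polyset (h j) `<=` H' by move=> x hx; exists j.
  apply: (computable_trans (T1 := polyset (fun s => h j s * g s))).
    apply: (computable_polyM mulM) => // [x /sh|x|s|s].
    + by move=> ?; left; right.
    + by rewrite /B => ?; inset.
    + by rewrite (leq_trans (szh j s)).
    + by rewrite (leq_trans (szg s)).
  apply: (@computable_subr _ _ _ _
    ((B `|` RD `|` H' `|` polyset (fun s => h j s * g s)) `|` polyset (h j.+1))).
    move=> x [k]; rewrite leq_eqVlt => /orP[/eqP-> hx|kj hx]; first by right.
    by left; left; right; exists k.
  apply/computable_keep/(compmod _ (fun s => h j s * g s)) => [s||]; [exact: szM| |]; subset.
pose A s := \matrix_(i < l, k < l) ((p s)`_(i * l + k)%N : {poly K}).
pose D s := \matrix_(k < l, t < l * l) blk n t (h k s).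
pose C i t s := comp_block n l (p s) (g s) (f s) i t.
have AD s i t : (A s *m D s) i t = C i t s.
  by rewrite !mxE; apply: eq_bigr => k _; rewrite !mxE.
have compC : computable (B `|` RD `|` H) Mx (mxset (fun s => A s *m D s)).
  have szA s i k : (size (A s i k) <= n)%N by rewrite mxE.
  have szD s k t : (size (D s k t) <= n)%N by rewrite mxE size_blk.
  apply: computable_subl (mulMx S A D szA szD) => x [] [i _ [k _ [u _ <-]]].
    do 5 left; exists (i * l + k)%N => //; exists u => //.
    by apply/funext => s; rewrite mxE.
  rewrite (_ : (fun s => _) = (fun s => (blk n k (h i s))`_u)); last first.
    by apply/funext => s; rewrite mxE.
  have : polyset (h i) `<=` (B `|` RD `|` H) `|` csts.
    by move=> y hy; left; right; exists i => //; exact: ltnW.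
  move/polyset_coefE => hc; apply: (polyset_poly (N := n)) => [j _|]; last exact: polyset_coef.
  exact: hc.
pose QS := \bigcup_(i in [set i | (i < l)%N]) polyset (q i).
have compQ : computable (mxset (fun s => A s *m D s)) (l * (2 * N)) QS.
  have compq (i : 'I_l) : computable (mxset (fun s => A s *m D s)) (2 * N) (polyset (q i)).
    have sC b : polyset (fun s => \sum_(t < l * l) blk n b (C i t s) * 'X^(t * n)) `<=`
        mxset (fun s => A s *m D s) `|` csts.
      move=> _ [u _ <-]; case: (ltnP (u %/ n)%N (l * l)) => ut; last first.
        right; exists 0 => //; apply/funext => s.
        rewrite (@coef_concat _ n (l * l) (fun t => blk n b (C i t s))) // => [|t]; last exact: size_blk.
        by rewrite ltnNge ut.
      left; exists i => //; exists (Ordinal ut) => //; exists (b * n + u %% n)%N => //.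
      apply/funext => s; rewrite AD.
      rewrite (@coef_concat _ n (l * l) (fun t => blk n b (C i t s))) // => [|t]; last exact: size_blk.
      by rewrite ut coef_poly ltn_mod n0.
    pose lo s := \sum_(t < l * l) blk n 0 (C i t s) * 'X^(t * n).
    pose hi s := \sum_(t < l * l) blk n 1 (C i t s) * 'X^(t * n).
    (* As [m <= l * l], the [l * l] blocks of length [n] cover all [n * m] coefficients. *)
    have qE s : q i s = lo s + hi s * 'X^n.
      apply: comp_row_blocks => // k; apply: leq_trans (szh k s) _.
      by rewrite /N mulnC leq_mul2r ml orbT.
    rewrite (_ : q i = fun s => lo s + hi s * 'X^n); last exact/funext.
    apply: computable_polyD; [exact: sC| |by move=> s; rewrite -qE].
    apply: polyset_free => u; case: (ltnP u n) => un.
      by right; exists 0 => //; apply/funext => s; rewrite coefMXn un.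
    have := polyset_coefE (sC 1%N) (u - n)%N; congr (_ `|` _) => /=.
    by apply/funext => s; rewrite coefMXn ltnNge un.
  have := computable_bigcup compq; rewrite card_ord; apply: computable_subr.
  by move=> x [i /= il qx]; exists (Ordinal il).
have compacc j : (j <= l)%N ->
    computable (B `|` RD `|` H `|` QS) (j * (M + (2 * N + (4 * M + L)))) (polyset (acc j)).
  elim: j => [|j IH] jl.
    by apply: computable0 => _ [i _ <-]; right; exists 0 => //; apply/funext => s; rewrite coef0.
  rewrite mulSn addnC; apply: computable_trans (IH (ltnW jl)) _.
  have sh : polyset (h l) `<=` H by move=> x hx; exists l.
  have sq : polyset (q (l - j.+1)%N) `<=` QS by move=> x hx; exists (l - j.+1)%N => //=; lia.
  apply: (computable_trans (T1 := polyset (fun s => acc j s * h l s))).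
    apply: (computable_polyM mulM) => // [x|x /sh|s|s].
    + by move=> ?; left; right.
    + by move=> ?; inset.
    + by rewrite (leq_trans (szacc j s)).
    + by rewrite (leq_trans (szh l s)).
  have szs s : (size (acc j s * h l s + q (l - j.+1)%N s)%R <= 2 * N)%N.
    by rewrite (leq_trans (size_polyD _ _)) // geq_max (szM _ _ (szacc j s) (szh l s)) szq.
  apply: (computable_trans (T1 := polyset (fun s => acc j s * h l s + q (l - j.+1)%N s))).
    apply: computable_polyD => // [|x /sq ?]; first by subset.
    by inset.
  by apply: compmod => //; subset.
rewrite (_ : (fun s => _) = acc l); last first.
  by apply/funext => s; rewrite -(@comp_hornerE K l) // (leq_trans (szp s)).
have cost_le : (L + M + (1 + e * (2 * M + L)) + (l * (5 * M + L) + (Mx + (l * (2 * N) +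
    l * (M + (2 * N + (4 * M + L)))))) <= L + M + 1 + e * (2 * M + L) + l * (11 * M + 4 * L) + Mx)%N.
  have : (l * (5 * M + L + 2 * N + (M + (2 * N + (4 * M + L)))) <= l * (11 * M + 4 * L))%N.
    by rewrite leq_mul2l; apply/orP; right; lia.
  rewrite !mulnDr; move: (e * _)%N => e'; lia.
have full := computable_trans compRD (computable_trans compH (computable_trans compC
  (computable_trans (computable_subl _ compQ) (computable_subl _ (compacc l (leqnn l)))))).
apply: (@computable_sub K S B B _ _ _ _ _ cost_le _ (full _ _)) => //; first by subset.
by move=> x [[[?|?]|?]|?]; inset.
Qed.

(** * Matrix multiplication programs *)

Lemma uniq_mxpairs a b : uniq (mxpairs a b).
Proof. by apply: allpairs_uniq; rewrite ?enum_uniq // => -[? ?] [? ?]. Qed.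

Lemma size_mxpairs a b : size (mxpairs a b) = (a * b)%N.
Proof. by rewrite size_allpairs !size_enum_ord. Qed.

Lemma exec_extends (K : fieldType) (e e' : seq K) (cs : seq (instr K)) :
  exec e cs = Some e' -> exists2 l, e' = e ++ l & size l = size cs.
Proof.
elim: cs e => [|i cs IH] e /=; first by case=> <-; exists [::]; rewrite ?cats0.
case: eval_instr => // v /IH[l -> szl]; exists (v :: l); first by rewrite cat_rcons.
by rewrite /= szl.
Qed.

(* The entries of a product are pairwise distinct functions of the two factors,
   and none of them is an entry of a factor. *)
Lemma cost_mulmx_geq (K : fieldType) (a b c : nat) (P : slp K) :
  (0 < b)%N -> computes_mulmx a b c P -> (a * c <= cost P)%N.
Proof.
move=> b0 hP; pose k0 := Ordinal b0.
pose inp (A : 'M[K]_(a, b)) (B : 'M[K]_(b, c)) := entries A ++ entries B.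
have szi A B : size (inp A B) = (a * b + b * c)%N.
  by rewrite size_cat !size_entries !size_mxpairs.
have hrun A B : exists2 l : seq K, size l = cost P &
   [/\ all (fun i => (i < a * b + b * c + cost P)%N) (outputs P) &
    [seq (inp A B ++ l)`_i | i <- outputs P] = entries (A *m B)].
  have := hP A B; rewrite /run; case E: exec => [e|//].
  have [l el szl] := exec_extends E; exists l => //.
  move: H; rewrite el size_cat -/(inp A B) szi szl.
  by case: ifP => // h [<-]; split.
have szo : size (outputs P) = (a * c)%N.
  have [l _ [_ /(congr1 size)]] := hrun 0 0.
  by rewrite size_map size_entries size_mxpairs.
pose o u := nth 0%N (outputs P) u.
pose ij0 : seq ('I_a * 'I_c) := mxpairs a c.
have outE A B : exists l : seq K, forall u (d : 'I_a * 'I_c), (u < a * c)%N ->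
    (inp A B ++ l)`_(o u) = (A *m B) (nth d ij0 u).1 (nth d ij0 u).2.
  have [l _ [_ hl]] := hrun A B; exists l => u d lu.
  have := congr1 (fun s : seq K => s`_u) hl.
  by rewrite (nth_map 0%N) ?szo // entriesE (nth_map d) ?size_mxpairs.
have uniqo : uniq (outputs P).
  apply/(uniqP 0%N) => u v; rewrite !inE szo => ltu ltv ouv.
  case E: ij0 => [|d t]; first by move: ltu; rewrite -size_mxpairs -/ij0 E.
  apply/eqP; rewrite -(nth_uniq d (s := ij0)) ?size_mxpairs ?uniq_mxpairs //.
  set x := nth d ij0 u; apply/eqP.
  (* The product of these unit matrices is nonzero only at [x], so a register shared by two outputs
     forces the same entry. *)
  have [l hl] := outE (delta_mx x.1 k0) (delta_mx k0 x.2).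
  have := hl u d ltu; rewrite -/x {1}/o ouv -/(o v) (hl v d ltv) mul_delta_mx !mxE !eqxx.
  case: eqP => [e1|_]; case: eqP => [e2|_] //= h;
    try by have /esym/eqP := h; rewrite oner_eq0.
  by rewrite [LHS]surjective_pairing -e1 -e2 -surjective_pairing.
have geo u : (u < a * c)%N -> (a * b + b * c <= o u)%N.
  move=> ltu; rewrite leqNgt; apply/negP => ou.
  case E: ij0 => [|d t]; first by move: ltu; rewrite -size_mxpairs -/ij0 E.
  set x := nth d ij0 u.
  pose A := delta_mx x.1 k0 : 'M[K]_(a, b); pose B := delta_mx k0 x.2 : 'M[K]_(b, c).
  (* An input register depends on one factor only. Replacing the other factor by zero leaves the
     register unchanged, but takes the entry of the product from 1 to 0. *)
  have val A' B' : (inp A' B')`_(o u) = (A' *m B') x.1 x.2.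
    by have [l /(_ u d ltu) <-] := outE A' B'; rewrite [RHS]nth_cat szi ou.
  have := val A B; rewrite /inp nth_cat size_entries size_mxpairs mul_delta_mx mxE !eqxx.
  case: ltnP => ouA.
    have := val A 0; rewrite /inp nth_cat size_entries size_mxpairs ouA mulmx0 mxE => ->.
    by move/esym/eqP; rewrite oner_eq0.
  have := val 0 B; rewrite /inp nth_cat size_entries size_mxpairs ltnNge ouA mul0mx mxE /= => ->.
  by move/esym/eqP; rewrite oner_eq0.
rewrite -szo -[cost P](size_iota (a * b + b * c)); apply: uniq_leq_size => // y /(nthP 0%N)[u].
rewrite szo => ltu <-; rewrite mem_iota geo //.
have [l _ [/allP/(_ (o u)) h _]] := hrun 0 0.
by apply: h; rewrite mem_nth ?szo.
Qed.

Lemma onth_map_mem (T : eqType) (U : Type) (F : T -> U) (s : seq T) x : x \in s ->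
  exists i, onth (map F s) i = Some (F x).
Proof.
elim: s => // y s IH; rewrite inE => /orP[/eqP ->|/IH[i hi]]; first by exists 0%N.
by exists i.+1.
Qed.

Lemma mem_onth_map (T : eqType) (U : Type) (F : T -> U) (s : seq T) i v :
  onth (map F s) i = Some v -> exists2 x, x \in s & v = F x.
Proof.
elim: s i => [|y s IH] [|i] //=; first by case=> <-; exists y; rewrite ?mem_head.
by case/IH => x xs ->; exists x; rewrite // inE xs orbT.
Qed.

(** An entry takes [3b] circuit operations. Translation multiplies by 4 and adds [a * c] for the
    outputs, whence 13. *)
Lemma naive_mulmx (K : fieldType) (a b c : nat) : (0 < b)%N ->
  exists2 P : slp K, computes_mulmx a b c P & (cost P <= 13 * (a * b * c))%N.
Proof.
move=> b0; pose S := ('M[K]_(a, b) * 'M[K]_(b, c))%type.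
pose inA ij (s : S) := s.1 ij.1 ij.2; pose inB ij (s : S) := s.2 ij.1 ij.2.
pose outM ij (s : S) := (s.1 *m s.2) ij.1 ij.2.
pose inp := map inA (mxpairs a b) ++ map inB (mxpairs b c).
pose B := [set v | exists i, onth inp i = Some v].
have BA ij : B (inA ij).
  have [|i hi] := @onth_map_mem _ _ inA (mxpairs a b) ij.
    by case: ij => i j; exact: mem_mxpairs.
  exists i; rewrite onth_cat hi; case: ltnP => // le.
  by rewrite onth_default in hi.
have BB ij : B (inB ij).
  have [|i hi] := @onth_map_mem _ _ inB (mxpairs b c) ij.
    by case: ij => i j; exact: mem_mxpairs.
  by exists (size (map inA (mxpairs a b)) + i)%N; rewrite onth_cat ltnNge leq_addr addKn.
have comp1 (ij : 'I_a * 'I_c) : computable B (b * 1 + 2 * b) [set outM ij].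
  have h (k : 'I_b) : computable B 1 [set fun s => inA (ij.1, k) s * inB (k, ij.2) s].
    by apply: computable1; apply: StepMul; left.
  have := computable_bigcup h; rewrite card_ord => h'; apply: computable_trans h' _.
  have -> : outM ij = fun s => \sum_(k < b) 1 * (inA (ij.1, k) s * inB (k, ij.2) s).
    by apply/funext => s; rewrite /outM mxE; apply: eq_bigr => k _; rewrite mul1r.
  by apply: computable_sum => k; left; right; exists k.
have compM := computable_bigcup comp1.
have [|P [leP hP]] := @slp_of_computable K S B (#|{: 'I_a * 'I_c}| * (b * 1 + 2 * b))
  inp (map outM (mxpairs a c)) (fun _ h => h).
  apply: computable_subr compM => v [i hv]; have [ij _ vE] := mem_onth_map hv.
  by exists ij => //; rewrite vE.
exists P => [X Y|].
  by have := hP (X, Y); rewrite !entriesE /inp map_cat -!map_comp => ->.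
apply: leq_trans leP _; rewrite size_map size_mxpairs card_prod !card_ord.
have : (a * c <= a * b * c)%N by rewrite mulnAC leq_pmulr.
by rewrite mulnAC; move: (a * c)%N => ac; nia.
Qed.

Lemma slp_comp_rem (K : fieldType) (n m l L M e Mx : nat) :
  (0 < n)%N -> (0 < m)%N -> (m <= l * l)%N -> (3 * (n * m) <= L)%N -> (L <= 2 ^ e)%N ->
  pmul_cost K L M -> mxmul_cost K l l (l * l) n Mx ->
  exists2 P : slp K, computes_comp_rem n m P &
    (cost P <= 4 * (L + M + 1 + e * (2 * M + L) + l * (11 * M + 4 * L) + Mx) + n * m)%N.
Proof.
move=> n0 m0 ml NL Le mulM mulMx.
pose valid (x : {poly {poly K}} * {poly K} * {poly K}) : Prop :=
  [/\ forall j, (size (x.1.1`_j)%R <= n)%N, (size x.1.1 <= m)%N,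
      (size x.1.2 <= n * m)%N, (size x.2 <= n * m)%N & x.2 != 0].
(* Restricting the circuit's inputs to valid ones makes the size bounds and [f != 0] hold at every
   [s]. *)
pose S := {x | valid x}.
pose p (s : S) := (sval s).1.1; pose g (s : S) := (sval s).1.2; pose f (s : S) := (sval s).2.
have comp := @computable_comp_rem K S n m l L M e Mx p g f n0 m0 ml NL Le mulM mulMx
  (fun s => let: And5 h _ _ _ _ := svalP s in h) (fun s => let: And5 _ h _ _ _ := svalP s in h)
  (fun s => let: And5 _ _ h _ _ := svalP s in h) (fun s => let: And5 _ _ _ h _ := svalP s in h)
  (fun s => let: And5 _ _ _ _ h := svalP s in h).
set c := (_ + Mx)%N in comp *.
pose F1 (ji : nat * nat) (s : S) := ((p s)`_ji.1)`_ji.2.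
pose F2 (i : nat) (s : S) := (g s)`_i; pose F3 (i : nat) (s : S) := (f s)`_i.
pose F4 (i : nat) (s : S) := ((p s).[g s] %% f s)`_i.
pose ji := [seq (j, i) | j <- iota 0 m, i <- iota 0 n].
pose inp := map F1 ji ++ map F2 (iota 0 (n * m)) ++ map F3 (iota 0 (n * m)).
pose B := [set v | exists i, onth inp i = Some v].
have fetch_cat (s1 s2 : seq (S -> K)) v :
    (exists i, onth s1 i = Some v) \/ (exists i, onth s2 i = Some v) ->
    exists i, onth (s1 ++ s2) i = Some v.
  case=> -[i hi].
    by exists i; rewrite onth_cat hi; case: ltnP => // le; rewrite onth_default in hi.
  by exists (size s1 + i)%N; rewrite onth_cat ltnNge leq_addr addKn.
have inB : (\bigcup_j polyset (fun s => (p s)`_j)) `|` polyset g `|` polyset f `<=` B `|` csts.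
  move=> x [[[j _ [i _ <-]]|[i _ <-]]|[i _ <-]].
  - case: (ltnP i n) => hi; last first.
      right; exists 0 => //; apply/funext => s; rewrite nth_default //.
      by apply: leq_trans hi; case: (svalP s).
    case: (ltnP j m) => hj; last first.
      right; exists 0 => //; apply/funext => s; rewrite (nth_default 0 (s := p s)) ?coef0 //.
      by apply: leq_trans hj; case: (svalP s).
    left; apply/fetch_cat; left; apply: (onth_map_mem F1 (x := (j, i))).
    by apply/allpairsP; exists (j, i); rewrite !mem_iota.
  - case: (ltnP i (n * m)) => hi; last first.
      right; exists 0 => //; apply/funext => s; rewrite nth_default //.
      by apply: leq_trans hi; case: (svalP s).
    left; apply/fetch_cat; right; apply/fetch_cat; left; apply: (onth_map_mem F2).
    by rewrite mem_iota.
  case: (ltnP i (n * m)) => hi; last first.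
    right; exists 0 => //; apply/funext => s; rewrite nth_default //.
    by apply: leq_trans hi; case: (svalP s).
  left; apply/fetch_cat; right; apply/fetch_cat; right; apply: (onth_map_mem F3).
  by rewrite mem_iota.
have [|P [leP hP]] := @slp_of_computable K S B c inp (map F4 (iota 0 (n * m))) (fun _ h => h).
  apply: computable_subr (computable_subl inB comp) => v [i hv].
  by have [j _ ->] := mem_onth_map hv; exists j.
exists P; last by rewrite size_map size_iota in leP.
move=> p0 g0 f0 h1 h2 h3 h4 h5.
have v0 : valid (p0, g0, f0) by split.
have := hP (exist _ _ v0); rewrite /inp !map_cat -!map_comp /coefs /mkseq => <-.
congr (run P (_ ++ _)); rewrite /ji map_allpairs /bicoefs /coefs /mkseq.
by elim: (iota 0 m) => //= a s ->.
Qed.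

(** * The exponent and the bound *)

Section Omega.
Variables (R : realType) (K : fieldType).

Lemma ceil_pow_nat (nu j : nat) : ceil_pow nu (j%:R : R) = (nu ^ j)%N.
Proof.
rewrite /ceil_pow powR_mulrn // -natrX.
by rewrite -[X in Num.ceil X]/(((nu ^ j)%N : int)%:~R) intrKceil.
Qed.

Definition mulmx_exponent : set R := [set tau | exists P : nat -> slp K,
  (forall nu, computes_mulmx nu nu (nu * nu) (P nu)) /\
  bigOh (fun nu : nat => nu%:R `^ tau) (fun nu => (cost (P nu))%:R)].

Lemma omega2E : omega2 R K = inf mulmx_exponent.
Proof.
rewrite /omega2 /omega; congr inf; apply/seteqP.
have c1 nu : ceil_pow nu (1 : R) = nu by rewrite (ceil_pow_nat nu 1) expn1.
have c2 nu : ceil_pow nu (2 : R) = (nu * nu)%N by rewrite (ceil_pow_nat nu 2) mulnn.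
by split=> tau [P [hP cP]]; exists P; split=> // nu; have := hP nu; rewrite c1 c2.
Qed.

Lemma mulmx_exponent_geq3 tau : mulmx_exponent tau -> 3 <= tau.
Proof.
case=> P [hP [C hC]]; rewrite leNgt; apply/negP => tau3.
have d0 : 0 < 3 - tau by rewrite subr_gt0.
have hle (nu : nat) : (0 < nu)%N -> nu%:R `^ (3 - tau) <= C.
  move=> nu0; have := cost_mulmx_geq nu0 (hP nu).
  rewrite -(ler_nat R) => h; have := hC nu; rewrite normr_nat => /(le_trans h).
  rewrite !natrM mulrA -!expr2 -exprSr -powR_mulrn // => h3.
  rewrite powRB; last by apply/implyP => _; rewrite pnatr_eq0 -lt0n.
  by rewrite ler_pdivrMr ?powR_gt0 ?ltr0n.
have C1 : 1 <= C by have := hle 1%N isT; rewrite powR1.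
(* Chosen so that [nu ^ (3 - tau)] is at least [C + 1]. *)
pose x := (C + 1) `^ (3 - tau)^-1; pose nu := Num.bound x.
have x0 : 0 <= x by exact: powR_ge0.
have xnu : x < nu%:R := archi_boundP x0.
have nu0 : (0 < nu)%N by rewrite -(ltr_nat R) (le_lt_trans x0 xnu).
have := hle nu nu0; rewrite leNgt => /negP; apply.
apply: (@lt_le_trans _ _ (C + 1)); first by rewrite ltrDl.
have -> : C + 1 = x `^ (3 - tau).
  by rewrite /x -powRrM mulVf ?powRr1 ?gt_eqF //; lra.
by apply: ge0_ler_powR; rewrite ?nnegrE ?ler0n //; exact: ltW.
Qed.

(** The naive product shows that the set of exponents is nonempty. *)
Lemma mulmx_exponent4 : mulmx_exponent 4.
Proof.
have [P hP] : exists P : nat -> slp K, forall nu,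
    computes_mulmx nu nu (nu * nu) (P nu) /\ (cost (P nu) <= 13 * nu ^ 4)%N.
  suff /choice[P hP] : forall nu, exists P : slp K,
      computes_mulmx nu nu (nu * nu) P /\ (cost P <= 13 * nu ^ 4)%N by exists P.
  case=> [|nu].
    exists (Slp [::] [::]); split=> // A B.
    by rewrite !entriesE /mxpairs (size0nil (size_enum_ord 0)).
  have [P hP leP] := @naive_mulmx K nu.+1 nu.+1 (nu.+1 * nu.+1) isT.
  exists P; split=> //; apply: leq_trans leP _.
  by rewrite leq_mul2l !expnS expn0 muln1 !mulnA leqnn orbT.
exists P; split=> [nu|]; first by case: (hP nu).
exists 13 => nu; rewrite normr_nat powR_mulrn // -natrX -natrM ler_nat.
by case: (hP nu).
Qed.

Lemma omega2_ge3 : 3 <= omega2 R K.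
Proof.
rewrite omega2E; apply: lb_le_inf; first by exists 4; exact: mulmx_exponent4.
by move=> tau; exact: mulmx_exponent_geq3.
Qed.

Lemma omega2_approx (d : R) : 0 < d ->
  exists2 tau, mulmx_exponent tau & tau < omega2 R K + d.
Proof.
move=> d0; rewrite omega2E; apply: inf_adherent => //; split.
  by exists 4; exact: mulmx_exponent4.
by exists 3 => tau; exact: mulmx_exponent_geq3.
Qed.

End Omega.

(** * Choice of parameters and estimates *)

Lemma ex_expn_geq (k x : nat) : (1 < k)%N -> (0 < x)%N ->
  exists j, (x <= k ^ j <= k * x)%N.
Proof.
move=> k1; case: x => // -[_|x _]; first by exists 0%N; rewrite expn0 muln1 /=; exact: ltnW.
have := up_log_bounds k1 (isT : 1 < x.+2)%N; set j := up_log k _ => /andP[lt le].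
exists j; rewrite le /=; case: j lt {le} => [|j] /= lt; first by rewrite expn0 muln_gt0 (ltnW k1).
by rewrite expnS leq_mul2l ltnW ?orbT.
Qed.

(** For the least [l] with [m <= l * l], either [l = 1], or [(l - 1)^2 < m] and [l <= 2 (l - 1)]. *)
Lemma ex_sqrt_geq (m : nat) : (0 < m)%N -> exists2 l, (0 < l)%N & (m <= l * l <= 4 * m)%N.
Proof.
move=> m0; have ex : exists l, (m <= l * l)%N by exists m; rewrite leq_pmulr.
case: (ex_minnP ex) => l ml min; have l0 : (0 < l)%N by case: l ml {min} => //; lia.
exists l => //; rewrite ml /=; case: l ml min l0 => // -[|l] ml min _; first by lia.
have : ~~ (m <= l.+1 * l.+1)%N by apply/negP => /min; rewrite ltnn.
rewrite -ltnNge; nia.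
Qed.

(* The rank [r <= 2 k 4^b] of [k = 2^(2^b - 1)] is [k^(1 + o(1))]. *)
Lemma polymul_decomp_eps (R : realType) (K : fieldType) (eps : R) : 0 < eps ->
  exists a (I : finType), let k := (2 ^ a)%N in
    [/\ polymul_decomp K k I, (1 < k)%N, (k < #|I|)%N &
        (2 * #|I|)%:R <= k%:R `^ (1 + eps)].
Proof.
(* With [a = 2 ^ b - 1], the bound [2 #|I| <= k 2 ^ (2 (b + 1))] reduces the claim to
   [2 (b + 1) <= a eps]. This follows from [1 <= t eps] and [2 (b + 1) t <= a]. *)
move=> eps0; pose t := (Num.bound eps^-1).+1; pose b := (8 * t)%N.
have [I dI /andP[leI Ile]] := polymul_decomp_exists K b.
have tb : (2 * b.+1 * t <= (2 ^ b).-1)%N.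
  have -> : (2 ^ b = 2 ^ (4 * t) * 2 ^ (4 * t))%N by rewrite -expnD; congr (_ ^ _)%N; lia.
  have : (4 * t < 2 ^ (4 * t))%N by apply: ltn_expl.
  by rewrite /b; move: (2 ^ _)%N => u; nia.
have t0 : (0 < t)%N by [].
have b1 : (1 < 2 ^ (2 ^ b).-1)%N.
  rewrite -[X in (X < _)%N](expn0 2) ltn_exp2l //; nia.
exists (2 ^ b).-1, I; split=> //.
  by apply: leq_trans leI; rewrite mul2n -addnn -[X in (X < _)%N]addn0 ltn_add2l ltnW.
set a := (2 ^ b).-1 in tb b1 leI Ile *.
have le1 : (2 * #|I|)%:R <= (2 ^ a * 2 ^ (2 * b.+1))%:R :> R.
  rewrite ler_nat; apply: leq_trans (leq_mul (leqnn 2) Ile) _.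
  rewrite expnM (_ : 2 ^ 2 = 4)%N // expnS; move: (2 ^ a)%N (4 ^ b)%N => x y; lia.
apply: le_trans le1 _.
rewrite natrM powRD ?powRr1 //; last by rewrite pnatr_eq0 expn_eq0 implybT.
rewrite ler_wpM2l // !natrX -!powR_mulrn // -powRrM.
apply: ler_powR; first by rewrite ler1n.
have te : 1 <= t%:R * eps.
  have h : eps^-1 < (Num.bound eps^-1)%:R by apply: archi_boundP; rewrite invr_ge0 ltW.
  by rewrite -ler_pdivrMr // div1r (le_trans (ltW h)) // ler_nat leqnSn.
have tb' : (2 * b.+1)%:R * t%:R <= a%:R :> R by rewrite -natrM ler_nat.
apply: le_trans (ler_wpM2r (ltW eps0) tb').
by rewrite -mulrA ler_peMr // ler0n.
Qed.

Lemma slp_comp_rem_decomp (K : fieldType) (a : nat) (I : finType) (n m l j j' : nat) (P : slp K) :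
  let k := (2 ^ a)%N in let r := #|I| in
  polymul_decomp K k I -> (1 < k)%N -> (k < r)%N -> (0 < n)%N -> (0 < m)%N ->
  (m <= l * l)%N -> (3 * (n * m) <= k ^ j)%N -> (n <= k ^ j')%N ->
  computes_mulmx l l (l * l) P ->
  exists2 Q : slp K, computes_comp_rem n m Q &
    (cost Q <= (80 + 12 * a) * (13 + 24 * r * k ^ 2) * (l * (2 * r) ^ j)
       + 4 * ((cost P + 24 * r * k ^ 2 * l ^ 3) * (2 * r) ^ j'))%N.
Proof.
move=> k r dI k1 kr n0 m0 ml nmL nj' hP.
have k0 : (0 < k)%N := ltnW k1.
have [P1 hP1 leP1] := @naive_mulmx K 1 1 1 isT.
have mul1 := mxmul_cost_leq (leqnn 1) leP1 (mxmul_cost_slp hP1).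
(* The naive scalar product costs 13, and [24 = 8 * 3] comes from the three [1 x 1] matrices. *)
set c1 := (13 + 24 * r * k ^ 2)%N.
have mulM : pmul_cost K (k ^ j) (c1 * r ^ j).
  apply: pmul_cost_mx; apply: mxmul_cost_leq (mxmul_cost_expn (j := j) dI kr k0 mul1) => //.
  by rewrite leq_mul2r; apply/orP; right; rewrite /c1 -/r; lia.
have mulMx : mxmul_cost K l l (l * l) n ((cost P + 24 * r * k ^ 2 * l ^ 3) * (2 * r) ^ j').
  apply: mxmul_cost_leq (mxmul_cost_expn (j := j') dI kr k0 (mxmul_cost_slp hP)) => //.
  apply: leq_mul; last first.
    by case: (posnP j') => [->|j0] //; rewrite leq_exp2r // leq_pmull.
  have ll : (l * l <= l * (l * l))%N by case: (l) => // l'; rewrite leq_pmull.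
  rewrite leq_add2l -/r (_ : 24 * r * k ^ 2 * l ^ 3 = 8 * r * k ^ 2 * (3 * (l * (l * l))))%N.
    by rewrite leq_mul2l; apply/orP; right; move: (l * (l * l))%N ll => x; lia.
  by rewrite !expnS; ring.
have kaj : (k ^ j <= 2 ^ (a * j))%N by rewrite expnM.
have [Q hQ leQ] := slp_comp_rem n0 m0 ml nmL kaj mulM mulMx.
exists Q => //; apply: leq_trans leQ _.
set Mx := (_ * (2 * r) ^ j')%N; set M := (c1 * r ^ j)%N.
have l0 : (0 < l)%N.
  by rewrite lt0n; apply/eqP => l00; move: ml m0; rewrite l00 leqn0 => /eqP ->.
have r0 : (0 < r)%N by apply: leq_trans kr.
have LM : (k ^ j <= M)%N.
  apply: (@leq_trans (r ^ j)); last by rewrite leq_pmull.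
  by case: (posnP j) => [->|j0] //; rewrite leq_exp2r // ltnW.
have nmM : (3 * (n * m) <= M)%N by exact: leq_trans nmL LM.
have M0 : (0 < M)%N by rewrite muln_gt0 expn_gt0 r0.
(* The [a * j] Newton rounds bring in a factor [j], absorbed by doubling the rank: [j < 2 ^ j]. *)
have jM : (j.+1 * M <= c1 * (2 * r) ^ j)%N.
  by rewrite /M mulnCA leq_mul2l expnMn leq_mul2r ltn_expl ?orbT.
have lM : (j.+1 * M * l <= c1 * (l * (2 * r) ^ j))%N.
  by rewrite [(l * _)%N]mulnC mulnA leq_mul2r jM orbT.
apply: (@leq_trans ((80 + 12 * a) * (j.+1 * M * l) + 4 * Mx)); last first.
  rewrite leq_add2r -/c1; move: (80 + 12 * a)%N => u.
  by rewrite -(mulnA u c1); apply: leq_mul (leqnn u) lM.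
have hl : (M <= M * l)%N by rewrite leq_pmulr.
have hj : (j * M <= j * M * l)%N by rewrite leq_pmulr.
have haj : (a * (j * M) <= a * (j * M * l))%N by rewrite leq_mul2l hj orbT.
have hL : (a * j * k ^ j <= a * (j * M))%N by rewrite -mulnA leq_mul2l leq_mul2l LM !orbT.
have hlL : (l * k ^ j <= l * M)%N by rewrite leq_mul2l LM orbT.
move: (k ^ j)%N LM hL hlL => L LM hL hlL.
clear - LM hL hlL nmM M0 hl hj haj.
move: M Mx LM hL hlL nmM M0 hl hj haj => M Mx LM hL hlL nmM M0 hl hj haj.
lia.
Qed.

Section Bound.
Variables (R : realType) (K : fieldType).
Local Notation w := (omega2 R K).
Local Notation F n m := (n%:R * m%:R `^ (w / 2) : R).

Lemma powR_sqrt_le (l m : nat) (s : R) : 0 <= s -> (l * l <= 4 * m)%N ->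
  l%:R `^ s <= 2 `^ s * m%:R `^ (s / 2).
Proof.
move=> s0 lm.
have E (x : R) : 0 <= x -> x `^ s = (x * x) `^ (s / 2).
  by move=> x0; rewrite -expr2 -powR_mulrn // -powRrM; congr (_ `^ _); field.
have -> : 2 `^ s * m%:R `^ (s / 2) = (4 * m)%:R `^ (s / 2).
  by rewrite natrM powRM // (E 2) // -natrM.
rewrite E // -natrM; apply: ge0_ler_powR; rewrite ?nnegrE ?ler_nat //.
by rewrite divr_ge0.
Qed.

Lemma expn_le_powR (k r j y : nat) (eps : R) : 0 <= eps -> r%:R <= k%:R `^ (1 + eps) ->
  (k ^ j <= y)%N -> (r ^ j)%:R <= y%:R `^ (1 + eps).
Proof.
move=> eps0 rk ky; apply: (@le_trans _ _ ((k ^ j)%:R `^ (1 + eps))); last first.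
  by apply: ge0_ler_powR; rewrite ?nnegrE ?ler_nat ?addr_ge0.
rewrite !natrX -(powR_mulrn j (ler0n _ k)) powRAC powR_mulrn ?powR_ge0 //.
by apply: lerXn2r; rewrite ?nnegrE ?powR_ge0.
Qed.

Lemma slp_comp_rem_bound (eps : R) : 0 < eps -> exists C : R, forall n m,
  exists2 P : slp K, computes_comp_rem n m P & (cost P)%:R <= C * F n m `^ (1 + eps).
Proof.
move=> eps0; have w3 : 3 <= w := omega2_ge3 R K.
(* The slack makes [tau < w (1 + eps)], so that [m ^ (tau / 2)] stays within the claimed bound. *)
have [|tau tauE tauw] := @omega2_approx R K (w * eps).
  by rewrite mulr_gt0 // (lt_le_trans _ w3).
have tau3 := mulmx_exponent_geq3 tauE.
have [PM [hPM [C0 hC0]]] := tauE.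
have [a [I [dI k1 kr rk]]] := polymul_decomp_eps K eps0.
set k := (2 ^ a)%N in dI k1 kr rk; set r := #|I| in kr rk.
pose c1 := (80 + 12 * a) * (13 + 24 * r * k ^ 2)%N; pose c2 := (24 * r * k ^ 2)%N.
pose C : R := c1%:R * (2 * (k * 3)%:R `^ (1 + eps)) +
  4 * ((C0 + c2%:R) * (2 `^ tau) * k%:R `^ (1 + eps)).
have C00 : 0 <= C0.
  by have := hC0 1%N; rewrite normr_nat powR1 mulr1; apply: le_trans.
have C_ge0 : 0 <= C.
  by rewrite /C; do ?[exact: powR_ge0|exact: ler0n|exact: C00|apply: addr_ge0|apply: mulr_ge0].
exists C => n m.
(* For [n = 0] or [m = 0] no nonzero [f] is admissible, and the empty program will do. *)
have [->|n0] := posnP n.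
  exists (Slp [::] [::]); last by rewrite mulr_ge0 ?powR_ge0.
  by move=> p g f _ _ _; rewrite mul0n leqn0 size_poly_eq0 => /eqP ->; rewrite eqxx.
have [->|m0] := posnP m.
  exists (Slp [::] [::]); last by rewrite mulr_ge0 ?powR_ge0.
  by move=> p g f _ _ _; rewrite muln0 leqn0 size_poly_eq0 => /eqP ->; rewrite eqxx.
have [l l0 /andP[ml lm]] := ex_sqrt_geq m0.
have [|j /andP[lej jle]] := @ex_expn_geq k (3 * (n * m)) k1.
  by rewrite !muln_gt0 n0 m0.
have [j' /andP[lej' j'le]] := ex_expn_geq k1 n0.
have [Q hQ leQ] := slp_comp_rem_decomp dI k1 kr n0 m0 ml lej lej' (hPM l).
exists Q => //; move: leQ; rewrite -/r -/k -/c2 -/c1 -(ler_nat R) => leQ.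
apply: (le_trans leQ).
have eps1 : 0 <= 1 + eps by rewrite addr_ge0 // ltW.
have m1 : 1 <= m%:R :> R by rewrite ler1n.
pose X := n%:R `^ (1 + eps); pose th := w / 2 * (1 + eps).
have FE : F n m `^ (1 + eps) = X * m%:R `^ th.
  by rewrite powRM ?powR_ge0 // -powRrM.
have X0 : 0 <= X by exact: powR_ge0.
have w0 : 0 <= w * eps by rewrite mulr_ge0 ?ltW // (lt_le_trans _ w3).
have e3 : 3 * eps <= w * eps by rewrite ler_pM2r.
(* The operations modulo [f] give [m] the exponent [3 / 2 + eps], which is at most [th] because
   [3 <= w]. *)
have hj : (l * (2 * r) ^ j)%:R <= 2 * (k * 3)%:R `^ (1 + eps) * (X * m%:R `^ th).
  have h1 : l%:R <= 2 * m%:R `^ (1 / 2) :> R.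
    by have := powR_sqrt_le (ler01 : 0 <= 1 :> R) lm; rewrite !powRr1.
  have h2 := expn_le_powR (ltW eps0) rk jle.
  rewrite natrM; apply: (le_trans (ler_pM _ _ h1 h2)) => //.
  rewrite mulnA natrM powRM // [(n * m)%:R]natrM powRM //.
  have -> : 2 * m%:R `^ (1 / 2) *
      ((k * 3)%:R `^ (1 + eps) * (n%:R `^ (1 + eps) * m%:R `^ (1 + eps))) =
     2 * (k * 3)%:R `^ (1 + eps) * (X * (m%:R `^ (1 / 2) * m%:R `^ (1 + eps))) by rewrite /X; ring.
  rewrite -powRD; last by rewrite pnatr_eq0 -lt0n m0 implybT.
  rewrite ler_wpM2l ?mulr_ge0 ?powR_ge0 // ler_wpM2l // ler_powR // /th.
  by lra.
(* The matrix products; [3 <= tau] lets [l ^ tau] absorb [l ^ 3]. *)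
have hj' : ((cost (PM l) + c2 * l ^ 3) * (2 * r) ^ j')%:R <=
    (C0 + c2%:R) * 2 `^ tau * k%:R `^ (1 + eps) * (X * m%:R `^ th).
  have h1 : (cost (PM l) + c2 * l ^ 3)%:R <= (C0 + c2%:R) * l%:R `^ tau.
    rewrite natrD natrM mulrDl lerD //.
      by have := hC0 l; rewrite normr_nat.
    by rewrite ler_wpM2l // natrX -powR_mulrn // ler_powR // ler1n.
  have h2 := expn_le_powR (ltW eps0) rk j'le.
  have h3 := powR_sqrt_le (le_trans (ler0n _ 3) tau3) lm.
  rewrite natrM; apply: (@le_trans _ _
    ((C0 + c2%:R) * (2 `^ tau * m%:R `^ (tau / 2)) * (k * n)%:R `^ (1 + eps))).
    apply: ler_pM => //; apply: (le_trans h1); rewrite ler_wpM2l // addr_ge0 //.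
  rewrite natrM powRM //.
  have -> : (C0 + c2%:R) * (2 `^ tau * m%:R `^ (tau / 2)) *
      (k%:R `^ (1 + eps) * n%:R `^ (1 + eps)) =
    (C0 + c2%:R) * 2 `^ tau * k%:R `^ (1 + eps) * (X * m%:R `^ (tau / 2)) by rewrite /X; ring.
  rewrite ler_wpM2l ?mulr_ge0 ?addr_ge0 ?powR_ge0 // ler_wpM2l // ler_powR // /th.
  by lra.
rewrite FE natrD natrM [(4 * _)%:R]natrM /C [leRHS]mulrDl; apply: lerD; rewrite -[leRHS]mulrA.
  exact: ler_wpM2l hj.
exact: ler_wpM2l hj'.
Qed.

End Bound.

Theorem theorem4p2 (R : realType) (K : fieldType) :
  exists P : nat -> nat -> slp K,
    (forall n m : nat, computes_comp_rem n m (P n m)) /\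
    soft_bigOh
      (fun nm : nat * nat => nm.1%:R * nm.2%:R `^ (omega2 R K / 2) : R)
      (fun nm : nat * nat => (cost (P nm.1 nm.2))%:R).
Proof.
(* Programs of minimal cost meet all the bounds, one for each [eps]. *)
have minP (nm : nat * nat) : exists P : slp K, computes_comp_rem nm.1 nm.2 P /\
    forall Q : slp K, computes_comp_rem nm.1 nm.2 Q -> (cost P <= cost Q)%N.
  (* Any [eps] would serve here: only the existence of a correct program is used. *)
  have [C hC] := @slp_comp_rem_bound R K 1 ltr01.
  pose good c := `[< exists2 Q : slp K, computes_comp_rem nm.1 nm.2 Q & cost Q = c >].
  have exg : exists c, good c.
    by have [Q hQ _] := hC nm.1 nm.2; exists (cost Q); apply/asboolP; exists Q.
  case: (ex_minnP exg) => c /asboolP[P hP <-] min; exists P; split=> // Q hQ.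
  by apply: min; apply/asboolP; exists Q.
have [P hP] := choice minP; exists (fun n m => P (n, m)); split=> [n m|eps /= eps0].
  by case: (hP (n, m)).
have [C hC] := slp_comp_rem_bound K eps0; exists C => -[n m] /=.
have [Q hQ leQ] := hC n m; rewrite normr_nat; apply: le_trans leQ.
by rewrite ler_nat; case: (hP (n, m)) => _; apply.
Qed.
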